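(* Let $2\le k\le n-2$ and let $I_1,\ldots,I_m$ be $k$-element subsets of $\{1,\ldots,n\}$, with corresponding vertices $e_{I_1},\ldots,e_{I_m}\in\Delta_{k,n}$. The blade arrangement $$\{((1,2,\ldots,n))_{e_{I_1}},((1,2,\ldots,n))_{e_{I_2}},\ldots,((1,2,\ldots,n))_{e_{I_m}}\}$$ induces a matroid subdivision of $\Delta_{k,n}$ if and only if $\{I_1,\ldots,I_m\}$ is weakly separated.
   Context: Notation. $e_J=\sum_{j\in J}e_j$, $x_J=\sum_{j\in J}x_j$, $\mathcal H_{r,n}=\{x\in\mathbb R^n:\sum_i x_i=r\}$, $\Delta_{k,n}=\{x\in[0,1]^n:\sum_i x_i=k\}$. The blade $((1,2,\ldots,n))\subset\mathcal H_{0,n}$ is the union over $i=1,\ldots,n$ of the boundaries (relative to $\mathcal H_{0,n}$) of the $n$ cones $[i,i+1,\ldots,i-1]=\{x\in\mathcal H_{0,n}: x_i\ge0,\ x_i+x_{i+1}\ge0,\ \ldots,\ x_i+x_{i+1}+\cdots+x_{i-2}\ge0\}$ (indices cyclic modulo $n$), which form a complete simplicial fan. $((1,2,\ldots,n))_{p}$ denotes its translate by $p\in\mathbb R^n$. An arrangement of blades $((1,2,\ldots,n))_{e_{I_1}},\ldots,((1,2,\ldots,n))_{e_{I_m}}$ induces the subdivision of $\Delta_{k,n}$ which is the common refinement of the subdivisions induced by the individual blades: its maximal cells are the $(n-1)$-dimensional intersections $\Delta_{k,n}\cap K_1\cap\cdots\cap K_m$, where $K_a$ is one of the $n$ cones above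 translated by $e_{I_a}$. It is a matroid subdivision if every maximal cell is a matroid polytope, i.e. the convex hull of the points $e_B$ where $B$ runs over the bases of a rank $k$ matroid on $\{1,\ldots,n\}$. Two $k$-element subsets $I,J$ of $\{1,\ldots,n\}$ are weakly separated if there are no four elements $i_1,i_2\in I\setminus J$ and $j_1,j_2\in J\setminus I$ with $i_1<j_1<i_2<j_2$ or one of its cyclic rotations. A collection of $k$-element subsets is weakly separated if its members are pairwise weakly separated. *)

(* Defs.v *)
From mathcomp Require Import all_boot all_order all_algebra.
From mathcomp Require Import boolp classical_sets reals.

Set Implicit Arguments.
Unset Strict Implicit.
Unset Printing Implicit Defensive.

Import Order.TTheory GRing.Theory Num.Theory.

Local Open Scope ring_scope.
Local Open Scope classical_set_scope.

(* The ground set {1, ..., n} is 'I_n (so shifted by one), and points of R^n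
   are row vectors. *)

Section Convexity.
Variable R : realType.

Definition conv_hull (V : lmodType R) (S : set V) : set V :=
  [set x | exists (N : nat) (p : 'I_N -> V) (w : 'I_N -> R),
     [/\ forall i, S (p i), forall i, 0 <= w i, \sum_i w i = 1
       & x = \sum_i w i *: p i]].

(* The affine hull of S, i.e. the smallest affine subspace containing S, is
   p + U with \dim U = d. In particular S is nonempty. *)
Definition has_affine_dim (V : vectType R) (S : set V) (d : nat) : Prop :=
  exists (p : V) (U : {vspace V}),
    [/\ S p, S `<=` [set x | x - p \in U],
        forall W : {vspace V}, S `<=` [set x | x - p \in W] -> (U <= W)%VS
      & \dim U = d].

End Convexity.

Section Matroid.

Definition matroid_bases (T : finType) (k : nat) (BB : {set {set T}}) : Prop :=
  [/\ BB != finset.set0,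
      forall B, B \in BB -> #|B| = k
    & forall A B, A \in BB -> B \in BB -> forall a, a \in A :\: B ->
        exists2 b, b \in B :\: A & b |: (A :\ a) \in BB].

Definition indicator_vec (R : realType) (n : nat) (J : {set 'I_n}) : 'rV[R]_n :=
  \sum_(j in J) delta_mx 0 j.

Definition matroid_polytope (R : realType) (n k : nat) (P : set 'rV[R]_n) : Prop :=
  exists2 BB : {set {set 'I_n}}, matroid_bases k BB &
    P = conv_hull [set indicator_vec R B | B in [set` BB]].

End Matroid.

Section Blades.
Variables (R : realType) (n : nat).

Definition hypersimplex (k : nat) : set 'rV[R]_n :=
  [set x | (forall i, 0 <= x 0 i <= 1) /\ \sum_i x 0 i = k%:R].

(* The cone [i, i+1, ..., i-1]; the t-th cyclic successor of i is
   iter t (@ordS n) i, and l is the number of terms of the partial sum. *)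
Definition blade_cone (i : 'I_n) : set 'rV[R]_n :=
  [set x | \sum_j x 0 j = 0 /\
     forall l : nat, (0 < l < n)%N ->
       0 <= \sum_(t < l) x 0 (iter t (@ordS n) i)].

(* The blade ((1,2,...,n))_p is the union of the boundaries of the n cones
   [i, ..., i-1] translated by p, which are the maximal cones of a complete
   fan with apex p; the subdivision it induces is given by these cones. *)
Definition blade_fan (p : 'rV[R]_n) : set (set 'rV[R]_n) :=
  [set K | exists i : 'I_n, K = [set x + p | x in blade_cone i]].

(* Maximal cells of the common refinement of the subdivisions of the
   hypersimplex induced by the blades with apexes p 0, ..., p (m - 1). *)
Definition blade_maximal_cell (k m : nat) (p : 'I_m -> 'rV[R]_n) :
    set (set 'rV[R]_n) :=
  [set P | exists K : 'I_m -> set 'rV[R]_n,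
     [/\ forall a, blade_fan (p a) (K a),
         P = hypersimplex k `&` \bigcap_a K a
       & has_affine_dim P n.-1]].

Definition blades_induce_matroid_subdivision (k m : nat)
    (p : 'I_m -> 'rV[R]_n) : Prop :=
  forall P, blade_maximal_cell k p P -> matroid_polytope k P.

End Blades.

Section WeakSeparation.
Variable n : nat.
Implicit Types I J : {set 'I_n}.

Definition cyclically_ordered (a b c d : 'I_n) : bool :=
  [|| [&& a < b, b < c & c < d], [&& b < c, c < d & d < a],
      [&& c < d, d < a & a < b] | [&& d < a, a < b & b < c]]%N.

Definition weakly_separated I J : Prop :=
  ~ exists i1 i2 j1 j2 : 'I_n,
      [/\ i1 \in I :\: J, i2 \in I :\: J, j1 \in J :\: I, j2 \in J :\: I
        & cyclically_ordered i1 j1 i2 j2].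

Definition weakly_separated_collection (F : {set {set 'I_n}}) : Prop :=
  forall I J, I \in F -> J \in F -> I != J -> weakly_separated I J.

End WeakSeparation.

(* Main.v *)
(* Encode x by its periodic partial sums y. The blade cone at p translated by
   e_I is the set of x for which y - y_I is minimal at the cut p, where y_I is
   the partial sum function of e_I.  So every cell is an alcoved polytope: it is
   given by integer bounds on differences of values of y, and averaging the
   roundings floor (y + theta) writes each of its points as a convex combination
   of the e_B contained in it.

   If the I_s are weakly separated, basis exchange holds for these B.  A failed
   exchange of a out of A is witnessed by cyclic intervals avoiding a on which
   the bounds are tight for A; weak separation uncrosses two overlapping tight
   intervals, so disjoint tight intervals cover B \ A, and a count gives a
   contradiction.

   If I and J are not weakly separated, y_J - y_I crosses some level up, down,
   up, down, at a, b, c, d.  Then some y >= max (y_I + const, y_J) has half-integral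
   increments exactly at a, b, c, d, touches y_J after a and after c, and touches
   y_I + const after b and after d.  A full-dimensional cell containing the
   corresponding point, the centre of an octahedron, contains one diagonal of
   the octahedron but misses a vertex of each of the two other diagonals in such
   a way that exchange fails. *)
Require Import Defs.
From mathcomp Require Import all_boot all_order all_algebra.
From mathcomp Require Import boolp classical_sets reals.
From mathcomp Require Import zify lra.

Set Implicit Arguments.
Unset Strict Implicit.
Unset Printing Implicit Defensive.

Import Order.TTheory GRing.Theory Num.Theory.

(** * Cyclic partial counts *)

Section CyclicCounts.
Variable n : nat.
Local Notation N := n.+1.
Implicit Types (A B : {set 'I_N}) (e t u v : nat).

Lemma inZpDN t : @inZp n (t + N) = inZp t.
Proof. by apply: val_inj; rewrite /= modnDr. Qed.

Lemma inZp_ord (j : 'I_N) : inZp j = j.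
Proof. by apply: val_inj; rewrite /= modn_small. Qed.

Lemma iter_ordS (i : 'I_N) t : iter t (@ordS N) i = inZp (i + t).
Proof.
elim: t => [|t IHt] /=; first by rewrite addn0 inZp_ord.
by rewrite IHt; apply: val_inj; rewrite /= -addn1 modnDml addn1 addnS.
Qed.

(** Positions are unbounded and wrap around through [inZp], so a cyclic interval becomes an ordinary
    interval [[u, v)] and its count a difference of two values of [cnt B]. *)
Definition cnt B t : nat := \sum_(i < t) (inZp i \in B).

Lemma cntS B t : cnt B t.+1 = cnt B t + (inZp t \in B).
Proof. by rewrite /cnt big_ord_recr. Qed.

Lemma cnt_card B : cnt B N = #|B|.
Proof.
rewrite /cnt -sum1_card [RHS]big_mkcond.
by apply: eq_bigr => i _; rewrite inZp_ord; case: (i \in B).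
Qed.

Lemma cntDN B t : cnt B (t + N) = cnt B t + #|B|.
Proof.
elim: t => [|t IHt]; first by rewrite add0n cnt_card /cnt big_ord0.
by rewrite addSn !cntS inZpDN IHt addnAC.
Qed.

Lemma cntDMN B t q : cnt B (t + q * N) = cnt B t + q * #|B|.
Proof.
elim: q => [|q IHq]; first by rewrite !mul0n !addn0.
by rewrite !mulSnr addnA cntDN IHq addnA.
Qed.

Lemma cnt_modn A B t u : #|A| = #|B| -> t = u %[mod N] ->
  cnt A t + cnt B u = cnt A u + cnt B t.
Proof.
move=> AB tu; rewrite (divn_eq t N) (divn_eq u N) tu.
by rewrite ![_ * N + _]addnC !cntDMN AB; lia.
Qed.

Lemma cnt_diff_ex A B u v : u <= v -> cnt A v + cnt B u < cnt A u + cnt B v ->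
  exists2 e, u <= e < v & inZp e \in B :\: A.
Proof.
elim: v => [|v IHv] uv; first by (have -> : u = 0 by lia); lia.
have [<-|neq] := eqVneq u v.+1; first by lia.
rewrite !cntS => lt_uv.
case eBA: (inZp v \in B :\: A); first by exists v => //; lia.
have le_v : (inZp v \in B) <= (inZp v \in A).
  by move: eBA; rewrite inE; case: (_ \in A); case: (_ \in B).
by have [| |e] := IHv; [lia | lia | exists e => //; lia].
Qed.

(** An argument [t] of [cnt] is a cut just before position [t]. Cuts are normalised to [(a, a + N]],
    positions in [inZp_lift] to [[a, a + N)], so every cut of the window comes after position
    [a]. *)
Lemma lift_mod a t : exists2 u, a < u <= a + N & u = t %[mod N].
Proof.
have N_gt0 : 0 < N by [].
pose r := (t + a.+1 * N - a.+1) %% N.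
exists (a.+1 + r); first by have := ltn_pmod (t + a.+1 * N - a.+1) N_gt0; rewrite -/r; lia.
rewrite /r modnDmr subnKC; last by rewrite mulnS; lia.
by rewrite addnC modnMDl.
Qed.

Lemma inZp_lift a (j : 'I_N) : exists2 e, a <= e < a + N & inZp e = j.
Proof.
have [u au eu] := lift_mod a j.+1; exists u.-1; first by lia.
have : u.-1.+1 = j.+1 %[mod N] by rewrite prednK //; lia.
rewrite -(addn1 u.-1) -(addn1 j) => /eqP; rewrite eqn_modDr => /eqP eq_uj.
by apply: val_inj; rewrite /= eq_uj modn_small.
Qed.

Lemma inZp_inj e e' : e <= e' < e + N -> @inZp n e = inZp e' -> e = e'.
Proof.
move=> ee' /(congr1 val) /= /esym/eqP; rewrite eqn_mod_dvd; last by lia.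
case/dvdnP=> q eq_q; case: q eq_q => [|q]; first by lia.
by rewrite mulSn; lia.
Qed.

Lemma cyclically_ordered_inZp e1 e2 e3 e4 :
  e1 < e2 -> e2 < e3 -> e3 < e4 -> e4 < e1 + N ->
  @cyclically_ordered N (inZp e1) (inZp e2) (inZp e3) (inZp e4).
Proof.
move=> h12 h23 h34 h41; rewrite /cyclically_ordered /=.
have dN := divn_eq e1 N; have rN : e1 %% N < N by rewrite ltn_pmod.
(* The quotient of [e] by [N] is that of [e1] or one more. The boolean [c] records the wrap-around,
   and its first occurrence selects the rotation. *)
have mod_e e : e1 <= e < e1 + N ->
    exists2 c : bool, e = e1 %/ N * N + c * N + e %% N & e %% N < N.
  move=> he; exists (e1 %/ N * N + N <= e); last by rewrite ltn_pmod.
  have dq : e %/ N = e1 %/ N + (e1 %/ N * N + N <= e).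
    apply/eqP; rewrite eqn_leq -ltnS ltn_divLR // leq_divRL // mulSn !mulnDl.
    by move: (e1 %/ N * N) dN => Q dN; case: leqP => ?; rewrite ?mul1n ?mul0n; lia.
  by rewrite -mulnDl -dq -divn_eq.
have [|c2 d2 r2] := mod_e e2; first by lia.
have [|c3 d3 r3] := mod_e e3; first by lia.
have [|c4 d4 r4] := mod_e e4; first by lia.
move: (e1 %/ N * N) (e1 %% N) (e2 %% N) (e3 %% N) (e4 %% N) dN rN d2 r2 d3 r3 d4 r4.
move=> Q q1 q2 q3 q4 ? ? d2 ? d3 ? d4 ? {mod_e}.
by case: c2 d2; case: c3 d3; case: c4 d4; rewrite ?mul1n ?mul0n => ? ? ?;
  apply/or4P; (constructor 1; lia) || (constructor 2; lia) ||
  (constructor 3; lia) || (constructor 4; lia) || (exfalso; lia).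
Qed.

Lemma cyclically_ordered_lift (a b c d : 'I_N) : cyclically_ordered a b c d ->
  exists e1 e2 e3 e4 : nat,
    [/\ e1 < e2, e2 < e3, e3 < e4 & e4 < e1 + N] /\
    [/\ inZp e1 = a, inZp e2 = b, inZp e3 = c & inZp e4 = d].
Proof.
have := ltn_ord a; have := ltn_ord b; have := ltn_ord c; have := ltn_ord d.
move=> ? ? ? ?; case/or4P=> /and3P[? ? ?].
- by exists a, b, c, d; rewrite !inZp_ord; split=> //; split=> //; lia.
- exists (a : nat), (b + N), (c + N), (d + N); rewrite !inZpDN !inZp_ord.
  by split=> //; split=> //; lia.
- exists (a : nat), (b : nat), (c + N), (d + N); rewrite !inZpDN !inZp_ord.
  by split=> //; split=> //; lia.
- exists (a : nat), (b : nat), (c : nat), (d + N); rewrite !inZpDN !inZp_ord.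
  by split=> //; split=> //; lia.
Qed.

End CyclicCounts.

(** * Basis exchange from weak separation *)

Section Exchange.
Variables (n m k : nat) (I : 'I_m -> {set 'I_n.+1}) (p : 'I_m -> nat).
Local Notation N := n.+1.
Hypothesis cardI : forall s, #|I s| = k.
Implicit Types (A B : {set 'I_N}) (a e t u v q : nat).

Definition feasible B := forall s t,
  cnt B (p s) + cnt (I s) t <= cnt B t + cnt (I s) (p s).

Lemma feasible_modn B s q t : #|B| = k -> feasible B -> q = p s %[mod N] ->
  cnt B q + cnt (I s) t <= cnt B t + cnt (I s) q.
Proof.
move=> cardB feasB eq_q; have := feasB s t.
have BI : #|B| = #|I s| by rewrite cardB cardI.
by have := cnt_modn BI eq_q; lia.
Qed.

(* No feasible set has more elements than [A] in the cyclic interval [u, q),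
   and this interval avoids [a]. *)
Definition tight A a u q := [/\ a < u, u < q, q <= a + N &
  exists2 s, q = p s %[mod N] & cnt A q + cnt (I s) u = cnt A u + cnt (I s) q].

(** Let [s] and [s'] witness the two intervals. If both alternatives fail, [cnt (I s) - cnt (I s')]
    exceeds a common threshold at [u] and [q] but not at [v] and [r]; its four changes around the
    cycle yield elements that contradict weak separation. *)
Lemma tight_cross A a u v q r : weakly_separated_collection [set I s | s : 'I_m]%SET ->
  #|A| = k -> feasible A -> tight A a u q -> tight A a v r ->
  u < v -> v < q -> q < r -> tight A a u r \/ tight A a q r.
Proof.
move=> wsI cardA feasA [au uq qa [s qs tAs]] [av vr ra [s' rs tAs']] uv vq qr.
have [tur|ntur] := eqVneq (cnt A r + cnt (I s') u) (cnt A u + cnt (I s') r).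
  by left; split=> //; [lia | exists s'].
have [tqr|ntqr] := eqVneq (cnt A r + cnt (I s') q) (cnt A q + cnt (I s') r).
  by right; split=> //; [lia | exists s'].
exfalso.
have minq t := feasible_modn t cardA feasA qs.
have minr t := feasible_modn t cardA feasA rs.
have := minq v; have := minq r; have := minr q; have := minr u.
have := minq (u + N); have := minr (u + N).
rewrite !cntDN cardA !cardI => mr1 mq1 mr2 mr3 mq2 mq3.
have [| |e1 he1 Je1] := @cnt_diff_ex n (I s) (I s') u v; [lia | lia |].
have [| |e2 he2 Ie2] := @cnt_diff_ex n (I s') (I s) v q; [lia | lia |].
have [| |e3 he3 Je3] := @cnt_diff_ex n (I s) (I s') q r; [lia | lia |].
have [| |e4 he4 Ie4] := @cnt_diff_ex n (I s') (I s) r (u + N).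
- lia.
- by rewrite !cntDN !cardI; lia.
apply: (wsI (I s') (I s)); rewrite ?imset_f //.
  by apply: contraTneq Je1 => ->; rewrite finset.setDv inE.
exists (inZp e1), (inZp e3), (inZp e2), (inZp e4); split=> //.
by apply: cyclically_ordered_inZp; lia.
Qed.

(* The head of the list is the rightmost interval. *)
Fixpoint tiles A a (l : seq (nat * nat)) (hi : nat) : Prop :=
  if l is (u, q) :: l' then [/\ tight A a u q, q <= hi & tiles A a l' u]
  else True.

Definition covers (l : seq (nat * nat)) e := has (fun uq => uq.1 <= e < uq.2) l.

Lemma tiles_le A a l hi hi' : hi <= hi' -> tiles A a l hi -> tiles A a l hi'.
Proof. by case: l => [|[u q] l] //= le_hi [? ? ?]; split=> //; lia. Qed.

(** The new interval is compared with the head: intervals that it contains are dropped, and a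
    partial overlap is uncrossed by [tight_cross] into a union or a disjoint remainder. *)
Lemma tiles_add A a l hi v r : weakly_separated_collection [set I s | s : 'I_m]%SET ->
  #|A| = k -> feasible A -> tiles A a l hi -> hi <= r -> tight A a v r ->
  exists2 l', tiles A a l' r & forall e, covers l e || (v <= e < r) -> covers l' e.
Proof.
move=> wsI cardA feasA.
elim: l hi => [|[u q] l IHl] hi /=.
  by move=> _ _ tvr; exists [:: (v, r)] => [|e] //=; rewrite orbF.
case=> tuq q_hi tl hi_r tvr.
have [qv|vq] := leqP q v.
  exists [:: (v, r), (u, q) & l] => //= e.
  by case/orP=> [/orP[]->|->]; rewrite ?orbT.
have [vu|uv] := leqP v u.
  have ur : u <= r by case: tuq; lia.
  have [l' tl' cl'] := IHl u tl ur tvr.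
  exists l' => // e h; apply: cl'; move: h => /=.
  by case: (covers l e); rewrite ?orbT //= ?orbF; lia.
have [qr|rq] := ltnP q r; last first.
  exists ((u, q) :: l) => /= [|e]; first by split=> //; lia.
  by case: (covers l e); rewrite ?orbT //= ?orbF; lia.
have [tur|tqr] := tight_cross wsI cardA feasA tuq tvr uv vq qr.
  exists ((u, r) :: l) => //= e.
  by case: (covers l e); rewrite ?orbT //= ?orbF; lia.
exists [:: (q, r), (u, q) & l] => //= e.
by case: (covers l e); rewrite ?orbT //= ?orbF; lia.
Qed.

Lemma tiles_cover A a hi : weakly_separated_collection [set I s | s : 'I_m]%SET ->
  #|A| = k -> feasible A -> exists2 l, tiles A a l hi &
    forall u q e, tight A a u q -> q <= hi -> u <= e < q -> covers l e.
Proof.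
move=> wsI cardA feasA; elim: hi => [|hi [l tl cl]].
  by exists [::] => // u q e [? ? ? _]; lia.
(* Inner induction: [U] bounds the left endpoints of those tight intervals ending at [hi.+1] that
   are already covered. *)
suff ext U : exists2 l', tiles A a l' hi.+1 & forall u q e,
    tight A a u q -> q <= hi \/ q = hi.+1 /\ u < U -> u <= e < q -> covers l' e.
  have [l' tl' cl'] := ext hi.+1.
  exists l' => // u q e tuq qhi; apply: cl' => //.
  by case: (tuq) => ? ? ? _; lia.
elim: U => [|U [l' tl' cl']].
  by exists l => [|u q e tuq [?|?]]; [exact: tiles_le tl | exact: cl | lia].
have [tU|ntU] := pselect (tight A a U hi.+1).
  have [l2 tl2 cl2] := tiles_add wsI cardA feasA tl' (leqnn _) tU.
  exists l2 => // u q e tuq hq ue; apply: cl2.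
  have [[eq_q eq_u]|neq] := pselect (q = hi.+1 /\ u = U).
    by rewrite -eq_q -eq_u ue orbT.
  by rewrite (cl' u q e) //; lia.
exists l' => // u q e tuq hq ue; apply: cl' ue => //.
case: hq => [|[eq_q ltu]]; [by left | right; split=> //].
have [eq_u|] := eqVneq u U; last by lia.
by case: ntU; rewrite -eq_u -eq_q.
Qed.

(** On a tile, [B] gains at most as much as [I s] by feasibility, and [A] exactly as much by
    tightness. Between tiles there is no element of [B :\: A], so there too [A] gains at least as
    much as [B]. *)
Lemma tiles_sum A B a l hi : #|B| = k -> feasible B -> tiles A a l hi ->
  a < hi -> (forall e, a < e < hi -> inZp e \in B :\: A -> covers l e) ->
  cnt A a.+1 + cnt B hi <= cnt A hi + cnt B a.+1.
Proof.
move=> cardB feasB.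
have mono u v : u <= v -> (forall e, u <= e < v -> inZp e \notin B :\: A) ->
    cnt A u + cnt B v <= cnt A v + cnt B u.
  move=> uv nBA; rewrite leqNgt; apply/negP=> lt_uv.
  have [|e he eBA] := @cnt_diff_ex n A B u v uv; first by lia.
  by have := nBA e he; rewrite eBA.
elim: l hi => [|[u q] l IHl] hi /=.
  move=> _ a_hi ncov; rewrite [X in _ <= X]addnC [X in _ <= X]addnC.
  by apply: mono => // e he; apply/negP => /(ncov e he).
case=> tuq q_hi tl a_hi cov; case: (tuq) => au uq qa [s qs tAs].
have := feasible_modn u cardB feasB qs.
have leqhi : cnt A q + cnt B hi <= cnt A hi + cnt B q.
  apply: mono => // e he; apply/negP => eBA.
  have /cov-/(_ eBA) : a < e < hi by lia.
  rewrite /covers /= => /orP[|ce]; first by lia.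
  suff : e < u by lia.
  elim: (l) (u) tl ce {IHl} => [|[u' q'] l' IHl'] u0 //= [[? ? ? _] ? tl'].
  by case/orP=> [|/IHl'-/(_ _ tl')]; lia.
have := IHl u tl au; suff: forall e, a < e < u -> inZp e \in B :\: A -> covers l e.
  by move=> h /(_ h); lia.
move=> e he eBA; have /cov-/(_ eBA) : a < e < hi by lia.
by rewrite /covers /= => /orP[|//]; lia.
Qed.

(** If no exchange is feasible, tight intervals cover [B :\: A], so [A] gains at least as much as
    [B] over the cycle without [a]. Both have [k] elements and only [A] contains [a], a
    contradiction. *)
Lemma feasible_exchange A B (a : 'I_N) :
  weakly_separated_collection [set I s | s : 'I_m]%SET ->
  #|A| = k -> #|B| = k -> feasible A -> feasible B -> a \in A :\: B ->
  exists2 b, b \in B :\: A & feasible (b |: (A :\ a)).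
Proof.
move=> wsI cardA cardB feasA feasB aAB; apply: contrapT => no_b.
have tight_b e : a < e < a + N -> inZp e \in B :\: A ->
    exists u q, tight A a u q /\ u <= e < q.
  move=> he; set b := inZp e => bBA.
  have aA : (a : 'I_N) \in A by move: aAB; rewrite inE => /andP[].
  have bA : b \notin A by move: bBA; rewrite inE => /andP[].
  pose A' := b |: (A :\ a); have cardA' : #|A'| = k.
    have aA1 : #|A :\ a|.+1 = k by rewrite -cardA (cardsD1 a A) aA.
    by rewrite cardsU1 !inE (negbTE bA) andbF.
  (* The window starts after [a], so inside it only the insertion at [e] changes increments, and by
     one. A bound violated by [A'] is therefore tight for [A], with [u <= e < q]. *)
  have cntA' t : a < t <= a + N ->
      cnt A' t + cnt A a.+1 = cnt A' a.+1 + cnt A t + (e < t).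
    elim: t => [|t IHt] ht; first by lia.
    have [eq_ta|neq_ta] := eqVneq t (a : nat); first by rewrite eq_ta; lia.
    have na : inZp t != a.
      apply: contraNneq neq_ta => eq_a; apply/eqP/esym/(@inZp_inj n); last first.
        by rewrite eq_a inZp_ord.
      lia.
    have nb : (inZp t == b) = (t == e).
      apply/eqP/eqP => [eq_tb|->//]; case: (leqP t e) => te.
        by apply: (@inZp_inj n) => //; lia.
      by apply/esym/(@inZp_inj n) => //; lia.
    have := IHt; rewrite !cntS !inE na nb /=.
    have [te|te] := eqVneq t e; last by lia.
    by have -> : (inZp t \in A) = false; [apply/negbTE; rewrite te | lia].
  have : ~ feasible A' by move=> feas_b; apply: no_b; exists b.
  move=> /existsNP[s /existsNP[t /negP]]; rewrite -ltnNge => viol.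
  have [u ua eu] := lift_mod n a t; have [q qa eq_q] := lift_mod n a (p s).
  exists u, q; have := feasible_modn u cardA feasA eq_q.
  have := cntA' u ua; have := cntA' q qa.
  have A'I : #|A'| = #|I s| by rewrite cardA' cardI.
  have := cnt_modn A'I eu; have := cnt_modn A'I eq_q.
  move=> h1 h2 h3 h4 h5; have [eu' qe] : u <= e /\ e < q by lia.
  by split; [split; [| | |exists s] |]; lia.
have [l tl cl] := tiles_cover a (a + N) wsI cardA feasA.
have /= := tiles_sum cardB feasB tl.
move: aAB; rewrite inE => /andP[aB aA].
rewrite !cntDN !cntS inZp_ord (negbTE aB) aA cardA cardB.
suff h : forall e, a < e < a + N -> inZp e \in B :\: A -> covers l e.
  by move=> /(_ _ h); lia.
move=> e he /(tight_b e he)[u [q [tuq ue]]]; case: (tuq) => _ _ qa _.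
exact: cl tuq qa ue.
Qed.

End Exchange.

(** * Cells and their partial sums *)

Section Cells.
Local Open Scope ring_scope.
Local Open Scope classical_set_scope.
Variables (R : realType) (n : nat).
Local Notation N := n.+1.
Implicit Types (x z : 'rV[R]_N) (B : {set 'I_N}) (t u : nat).

Definition psum x t : R := \sum_(i < t) x 0 (inZp i).

Lemma psum0 x : psum x 0 = 0.
Proof. by rewrite /psum big_ord0. Qed.

Lemma psumS x t : psum x t.+1 = psum x t + x 0 (inZp t).
Proof. by rewrite /psum big_ord_recr. Qed.

Lemma psumD x z t : psum (x + z) t = psum x t + psum z t.
Proof. by rewrite -big_split; apply: eq_bigr => i _; rewrite mxE. Qed.

Lemma psumZ c x t : psum (c *: x) t = c * psum x t.
Proof. by rewrite mulr_sumr; apply: eq_bigr => i _; rewrite mxE. Qed.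

Lemma psum_sum r (w : 'I_r -> R) (v : 'I_r -> 'rV[R]_N) t :
  psum (\sum_i w i *: v i) t = \sum_i w i * psum (v i) t.
Proof.
rewrite /psum; under [RHS]eq_bigr do rewrite mulr_sumr.
rewrite exchange_big; apply: eq_bigr => i _; rewrite summxE.
by apply: eq_bigr => j _; rewrite mxE.
Qed.

Lemma psum_total x : psum x N = \sum_j x 0 j.
Proof. by apply: eq_bigr => j _; rewrite inZp_ord. Qed.

Lemma psumDN x t : psum x (t + N) = psum x t + \sum_j x 0 j.
Proof.
elim: t => [|t IHt]; first by rewrite add0n psum_total psum0 add0r.
by rewrite addSn !psumS inZpDN IHt addrAC.
Qed.

Lemma psumDMN x t q : psum x (t + q * N) = psum x t + (\sum_j x 0 j) *+ q.
Proof.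
elim: q => [|q IHq]; first by rewrite mul0n addn0 mulr0n addr0.
by rewrite mulSnr addnA psumDN IHq mulrSr addrA.
Qed.

Lemma psum_modn x t u : \sum_j x 0 j = 0 -> t = u %[mod N] -> psum x t = psum x u.
Proof.
move=> x0 tu; rewrite (divn_eq t N) (divn_eq u N) tu ![(_ * N + _)%N]addnC.
by rewrite !psumDMN x0 !mul0rn.
Qed.

Lemma indicator_vecE B i j : indicator_vec R B i j = (j \in B)%:R.
Proof.
rewrite /indicator_vec summxE (ord1 i) big_mkcond (bigD1 j) //= mxE !eqxx.
rewrite big1 ?addr0; first by case: (j \in B).
by move=> l nlj; case: (l \in B); rewrite ?mxE //= (eq_sym j) (negbTE nlj).
Qed.

Lemma psum_indicator B t : psum (indicator_vec R B) t = (cnt B t)%:R.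
Proof.
by rewrite /cnt natr_sum; apply: eq_bigr => i _; rewrite indicator_vecE.
Qed.

Lemma sum_indicator B : \sum_j indicator_vec R B 0 j = #|B|%:R.
Proof. by rewrite -psum_total psum_indicator cnt_card. Qed.

(** The sums defining the cone are differences [psum x (i + l) - psum x i]. As the total is 0,
    [psum x] is periodic, so they compare [i] with every cut. *)
Lemma blade_coneP (i : 'I_N) x :
  blade_cone i x <-> \sum_j x 0 j = 0 /\ forall t, psum x i <= psum x t.
Proof.
have sumE l : \sum_(t < l) x 0 (iter t (@ordS N) i) = psum x (i + l) - psum x i.
  rewrite /psum big_split_ord /= addrAC subrr add0r.
  by apply: eq_bigr => t _; rewrite iter_ordS.
split=> -[x0 h]; split=> //; last by move=> l _; rewrite sumE subr_ge0.
move=> t.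
have [u iu eu] := lift_mod n i t; rewrite -(psum_modn x0 eu).
have -> : u = (i + (u - i))%N by lia.
(* The length [N] is outside the range of the cone inequalities; there the difference is the zero
   total. *)
have [eq_u|neq_u] := eqVneq (u - i)%N N.
  by rewrite eq_u psumDN x0 addr0.
by rewrite -subr_ge0 -sumE; apply: h; lia.
Qed.

Variables (k m : nat) (I : 'I_m -> {set 'I_N}).
Hypothesis cardI : forall s, #|I s| = k.

Definition cell (p : 'I_m -> 'I_N) : set 'rV[R]_N :=
  hypersimplex k `&`
  \bigcap_s [set x + indicator_vec R (I s) | x in blade_cone (p s)].

Lemma cellP p x : cell p x <->
  [/\ forall j, 0 <= x 0 j <= 1, \sum_j x 0 j = k%:R
    & forall s t, psum x (p s) + (cnt (I s) t)%:R <=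
                  psum x t + (cnt (I s) (p s))%:R].
Proof.
split=> [[[x01 xk] xK]|[x01 xk xK]]; split=> //.
  move=> s t; have [z /blade_coneP[z0 zmin] <-] := xK s Logic.I.
  by rewrite !psumD !psum_indicator addrAC lerD2r lerD2r.
move=> s _; exists (x - indicator_vec R (I s)); last by rewrite subrK.
apply/blade_coneP; split=> [|t].
  under eq_bigr do rewrite !mxE.
  by rewrite sumrB xk sum_indicator cardI subrr.
rewrite -scaleN1r !psumD !psumZ !psum_indicator !mulN1r.
by rewrite lerBlDr addrAC lerBrDr xK.
Qed.

Lemma blade_maximal_cellP P :
  blade_maximal_cell k (fun s => indicator_vec R (I s)) P <->
  exists2 p : 'I_m -> 'I_N, P = cell p & has_affine_dim P n.
Proof.
split=> [[K [fanK -> dimP]]|[p -> dimP]].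
  have [p pK] := choice fanK; exists p => //.
  by congr (_ `&` _); apply: eq_bigcapr => s _; rewrite pK.
by eexists; split; [| reflexivity | exact: dimP] => s; exists (p s).
Qed.

End Cells.

(** * Reals as averages of their roundings *)

Section Integrality.
Local Open Scope ring_scope.
Local Open Scope classical_set_scope.
Variable R : realType.

(** Only the gaps ending at or below [phi] count, and they telescope from [c] to [phi] because [phi]
    is itself a breakpoint. *)
Lemma layer_cake (c : R) (s : seq R) phi :
  path <=%R c s -> phi \in c :: s ->
  \sum_(i < size s) (nth 0 s i - nth 0 (c :: s) i) * (nth 0 s i <= phi)%R%:R =
  phi - c.
Proof.
elim: s c => [|a s IHs] c /=.
  by move=> _; rewrite inE => /eqP->; rewrite big_ord0 subrr.
move=> /andP[ca pa]; rewrite big_ord_recl /= => phis.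
have min_a b : b \in a :: s -> a <= b.
  rewrite inE => /orP[/eqP->//|bs].
  by have /allP := order_path_min le_trans pa; apply.
have [phi_as|nphi] := boolP (phi \in a :: s).
  by rewrite min_a // mulr1 IHs // addrC subrKA.
have eq_phi : phi = c by move: phis nphi; rewrite inE => /orP[/eqP|->].
have lt_ca : c < a.
  by rewrite lt_neqAle ca andbT; apply: contraNneq nphi => <-; rewrite eq_phi mem_head.
rewrite eq_phi subrr lt_geF // mulr0 add0r big1 // => i _.
have ai : a <= nth 0 s i by rewrite min_a // inE mem_nth ?orbT.
by rewrite lt_geF ?mulr0 // (lt_le_trans lt_ca).
Qed.

(** The mean of [floor (z + theta)] over uniform [theta] in [[0, 1]] is [z]. For finitely many [z] a
    finite sum suffices: the fractional parts cut [[0, 1]] into gaps, whose lengths are the weights,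
    and [theta] is 1 minus the right end of a gap. *)
Lemma floor_average (l : seq R) : exists r (w theta : 'I_r -> R),
  [/\ forall i, 0 <= w i, \sum_i w i = 1 &
      forall z, z \in l -> \sum_i w i * (Num.floor (z + theta i))%:~R = z].
Proof.
pose frac (z : R) := z - (Num.floor z)%:~R.
have frac01 z : 0 <= frac z < 1.
  have := floor_itv z; rewrite intrD /frac; move: (_%:~R) => c; lra.
pose s := sort <=%R (1 :: map frac l).
have ps : path <=%R 0 s.
  have := sort_le_sorted (1 :: map frac l); rewrite -/s.
  have : all (>= 0) s.
    rewrite all_sort /= ler01 /=; apply/allP => z /mapP[y _ ->].
    by case/andP: (frac01 y).
  by case: (s) => //= a s' /andP[-> _] ->.
have s01 z : z \in s -> 0 <= z <= 1.
  rewrite mem_sort inE => /orP[/eqP->|/mapP[y _ ->]]; first by rewrite ler01 lexx.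
  by have /andP[-> /ltW] := frac01 y.
exists (size s), (fun i : 'I_(size s) => nth 0 s i - nth 0 (0 :: s) i),
  (fun i : 'I_(size s) => 1 - nth 0 s i).
have floorE z tau : 0 <= tau <= 1 ->
    (Num.floor (z + (1 - tau)))%:~R = (Num.floor z)%:~R + (tau <= frac z)%R%:R :> R.
  move=> /andP[tau0 tau1]; have /andP[f0 f1] := frac01 z.
  case: leP => tz.
    rewrite (floor_def (m := Num.floor z + 1)) ?intrD //.
    by move: f1 tz; rewrite /frac mulr1z; move: (_%:~R) => c; lra.
  rewrite addr0 (floor_def (m := Num.floor z)) // intrD.
  by move: f0 f1 tz; rewrite /frac; move: (_%:~R) => c; lra.
have w1 : \sum_(i < size s) (nth 0 s i - nth 0 (0 :: s) i) = 1.
  have := layer_cake ps (phi := 1); rewrite inE mem_sort mem_head orbT subr0 => <- //.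
  apply: eq_bigr => i _; have /andP[_ ->] := s01 _ (mem_nth 0 (ltn_ord i)).
  by rewrite mulr1.
split=> [i||z zl] //.
- by rewrite subr_ge0; have /(pathP 0) := ps; apply.
- under eq_bigr => i _ do rewrite floorE ?s01 ?mem_nth // mulrDr.
  rewrite big_split /= layer_cake //; last first.
    by rewrite inE mem_sort inE map_f ?orbT.
  by rewrite -mulr_suml w1 mul1r subr0 addrC subrK.
Qed.

End Integrality.

(** * Cells as convex hulls of indicator vectors *)

Section CellHull.
Local Open Scope ring_scope.
Local Open Scope classical_set_scope.
Variables (R : realType) (n k m : nat) (I : 'I_m -> {set 'I_n.+1}).
Local Notation N := n.+1.
Hypothesis cardI : forall s, #|I s| = k.
Variable p : 'I_m -> 'I_N.
Implicit Types (x : 'rV[R]_N) (B : {set 'I_N}) (t : nat).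

Definition cell_bases : {set {set 'I_N}} :=
  [set B : {set 'I_N} | (#|B| == k) && `[< feasible I (fun s => p s) B >]]%SET.

Lemma cell_basesP B :
  B \in cell_bases <-> #|B| = k /\ feasible I (fun s => p s) B.
Proof. by rewrite inE; split=> [/andP[/eqP ? /asboolP]|[/eqP-> /asboolP]]. Qed.

Lemma cell_indicator B : cell k I p (indicator_vec R B) <-> B \in cell_bases.
Proof.
rewrite cell_basesP; split=> [/(cellP cardI _ _)[_]|[cardB feasB]].
  rewrite sum_indicator => /eqP; rewrite eqr_nat => /eqP cardB feasB; split=> // s t.
  by have := feasB s t; rewrite !psum_indicator -!natrD ler_nat.
apply/(cellP cardI _ _); split=> [j||s t].
- by rewrite indicator_vecE; case: (j \in B); rewrite ?lexx ler01.
- by rewrite sum_indicator cardB.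
- by rewrite !psum_indicator -!natrD ler_nat; apply: feasB.
Qed.

Lemma cell_convex r (w : 'I_r -> R) (v : 'I_r -> 'rV[R]_N) :
  (forall i, 0 <= w i) -> \sum_i w i = 1 -> (forall i, cell k I p (v i)) ->
  cell k I p (\sum_i w i *: v i).
Proof.
move=> w0 w1 vP; apply/(cellP cardI _ _).
have vE i := (cellP cardI _ _).1 (vP i).
have avg c : c = \sum_i w i * c by rewrite -mulr_suml w1 mul1r.
split=> [j||s t].
- rewrite summxE; apply/andP; split.
    apply: sumr_ge0 => i _; rewrite mxE mulr_ge0 //.
    by have [/(_ j)/andP[]] := vE i.
  rewrite [leRHS]avg; apply: ler_sum => i _; rewrite mxE ler_wpM2l //.
  by have [/(_ j)/andP[]] := vE i.
- rewrite -psum_total psum_sum [RHS]avg; apply: eq_bigr => i _.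
  by rewrite psum_total; have [_ ->] := vE i.
- rewrite !psum_sum [X in _ + X]avg [X in _ <= _ + X]avg -!big_split /=.
  apply: ler_sum => i _; rewrite -!mulrDr ler_wpM2l //.
  by have [_ _] := vE i; apply.
Qed.

(** The rounded partial sums grow by 0 or 1 per step and by [k] per period, so up to a constant they
    count a set of [k] elements. Rounding down preserves integer bounds on differences, hence the
    cell inequalities. *)
Lemma cell_rounding x theta : cell k I p x ->
  exists2 B, B \in cell_bases & forall j : 'I_N, (j \in B)%:R =
    (Num.floor (psum x j.+1 + theta))%:~R - (Num.floor (psum x j + theta))%:~R :> R.
Proof.
move=> /(cellP cardI _ _)[x01 xk xmin].
pose f t := Num.floor (psum x t + theta).
have floorDn y c : Num.floor (y + c%:R + theta) = Num.floor (y + theta) + c%:Z.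
  by rewrite addrAC floorDrz ?natr_int // -[c%:R]/(c%:Z%:~R) intrKfloor.
have fD t q : f (t + q * N)%N = f t + (k * q)%N%:Z.
  by rewrite /f psumDMN xk -mulrnA floorDn.
have fS t : f t <= f t.+1 <= f t + 1.
  have /andP[x0 x1] := x01 (inZp t).
  rewrite -(floorDn _ 1%N) !le_floor //= psumS; first by rewrite lerD2r lerD2l.
  by rewrite lerD2r lerDl.
pose B := [set j : 'I_N | f j < f j.+1]%SET.
have inB t : (inZp t \in B)%:Z = f t.+1 - f t.
  rewrite inE /=; have eq_t : t = (t %% N + (t %/ N) * N)%N by rewrite addnC -divn_eq.
  have -> : f t = f (t %% N)%N + (k * (t %/ N))%N%:Z by rewrite -fD -eq_t.
  have -> : f t.+1 = f (t %% N).+1 + (k * (t %/ N))%N%:Z by rewrite -fD addSn -eq_t.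
  by have := fS (t %% N)%N; move: (k * _)%N => c; lia.
have cntB t : (cnt B t)%:Z = f t - f 0%N.
  elim: t => [|t IHt]; first by rewrite /cnt big_ord0 subrr.
  by rewrite cntS PoszD IHt inB; lia.
exists B; last first.
  by move=> j; rewrite -intrB -[X in X%:~R]inB inZp_ord.
apply/cell_basesP; split=> [|s t].
  have := cntB N; rewrite cnt_card -[X in f X]add0n -[X in (0 + X)%N]mul1n fD; lia.
have := le_floor (lerD (xmin s t) (lexx theta)).
rewrite !floorDn -/(f t) -/(f (p s)).
by move: (cntB (p s)) (cntB t); move: (f t) (f (p s)) (f 0%N) => a b c; lia.
Qed.

Lemma cell_hull : cell k I p =
  conv_hull [set indicator_vec R B | B in [set` cell_bases]].
Proof.
apply/seteqP; split=> x.
  (* One common family of weights averages all these partial sums, so it also averages their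
     successive differences, the coordinates. *)
  move=> xP; pose l := [seq psum x t | t <- iota 0 N.+1].
  have [r [w [theta [w0 w1 avg]]]] := floor_average l.
  have /choice[B BP] i : exists B, B \in cell_bases /\ forall j : 'I_N,
      (j \in B)%:R = (Num.floor (psum x j.+1 + theta i))%:~R -
                     (Num.floor (psum x j + theta i))%:~R :> R.
    by have [B ? ?] := cell_rounding (theta i) xP; exists B.
  exists r, (fun i => indicator_vec R (B i)), w; split=> // [i|].
    by exists (B i) => //; have [] := BP i.
  apply/rowP=> j; rewrite summxE.
  have inl t : (t <= N)%N -> psum x t \in l.
    by move=> tN; apply: map_f; rewrite mem_iota; lia.
  have eqj := avg _ (inl j (ltnW (ltn_ord j))); have eqj1 := avg _ (inl j.+1 (ltn_ord j)).
  have xj : x 0 j = psum x j.+1 - psum x j.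
    by rewrite psumS inZp_ord addrAC subrr add0r.
  rewrite xj; apply: etrans (congr2 (fun a b => a - b) (esym eqj1) (esym eqj)) _.
  rewrite -sumrB; apply: eq_bigr => i _.
  by rewrite mxE indicator_vecE; have [_ ->] := BP i; rewrite mulrBr.
case=> r [v [w [vB w0 w1 ->]]]; apply: cell_convex => // i.
by have [B BB <-] := vB i; apply/cell_indicator.
Qed.

Lemma cell_matroid : weakly_separated_collection [set I s | s : 'I_m]%SET ->
  (exists x, cell k I p x) -> matroid_polytope k (cell (R := R) k I p).
Proof.
move=> wsI [x]; rewrite cell_hull => xP; exists cell_bases => //.
split.
- case: xP => -[|r] [v [w [vB _ w1 _]]].
    by move: w1; rewrite big_ord0 => /esym/eqP; rewrite oner_eq0.
  have [B BB _] := vB ord0; apply/set0Pn; by exists B.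
- by move=> B /cell_basesP[].
- move=> A B /cell_basesP[cA fA] /cell_basesP[cB fB] a aAB.
  have [b bBA fb] := feasible_exchange cardI wsI cA cB fA fB aAB.
  exists b => //; apply/cell_basesP; split=> //.
  move: aAB bBA; rewrite !inE => /andP[_ aA] /andP[bA _].
  by rewrite cardsU1 !inE (negbTE bA) andbF -cA (cardsD1 a A) aA.
Qed.

End CellHull.

(** * Full-dimensional cells *)

Section FullCells.
Local Open Scope ring_scope.
Local Open Scope classical_set_scope.
Variable R : realType.

Lemma small_perturbation (T : finType) (alpha beta : T -> R) :
  (forall i, 0 < alpha i \/ alpha i = 0 /\ 0 < beta i) ->
  exists2 e : R, 0 < e & forall i, 0 < alpha i + e * beta i.
Proof.
(* [S] bounds every [|beta i| / alpha i], so the step [(1 + S)^-1] keeps positive terms positive.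
   Where [alpha i = 0] the quotient is 0 by convention. *)
move=> pos; pose S := \sum_i `|beta i| / alpha i.
have term0 i : 0 <= `|beta i| / alpha i.
  by rewrite divr_ge0 //; case: (pos i) => [/ltW|[-> _]].
have S0 : 0 <= S by apply: sumr_ge0.
have S1 : 0 < 1 + S by rewrite ltr_pwDl.
exists (1 + S)^-1 => [|i]; first by rewrite invr_gt0.
case: (pos i) => [ai|[-> bi]]; last by rewrite add0r mulr_gt0 ?invr_gt0.
rewrite -(pmulr_rgt0 _ S1) mulrDr mulVKf ?gt_eqF //.
have le_S : `|beta i| <= alpha i * S.
  rewrite mulrC -ler_pdivrMr // /S (bigD1 i) //= lerDl.
  by apply: sumr_ge0 => j _.
have := ler_norm (- beta i); rewrite normrN mulrDl mul1r (mulrC S).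
by lra.
Qed.

(** Here [h] acts as an infinitesimal perturbation of [g]: the minimiser found is the strict
    minimiser of [g + e * h] on the window for small [e > 0]. *)
Lemma lex_argmin a L (g h : nat -> R) : (0 < L)%N ->
  (forall t u, (a < t <= a + L)%N -> (a < u <= a + L)%N -> h t = h u -> t = u) ->
  exists2 q, (a < q <= a + L)%N & forall t, (a < t <= a + L)%N -> t != q ->
    g q < g t \/ g q = g t /\ h q < h t.
Proof.
elim: L => // -[_ _ _|L IHL _ inj_h].
  by exists a.+1 => [|t]; lia.
have [//|t u ht hu|q hq qmin] := IHL; first by apply: inj_h; lia.
pose r := (a + L.+2)%N.
have old t : (a < t <= r)%N -> t != r -> (a < t <= a + L.+1)%N by rewrite /r; lia.
have hqr : h q != h r.
  by apply/eqP => /inj_h eq_qr; have := hq; rewrite eq_qr /r; lia.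
have keep : g q < g r \/ g q = g r /\ h q < h r ->
    exists2 q0, (a < q0 <= r)%N & forall t, (a < t <= r)%N -> t != q0 ->
    g q0 < g t \/ g q0 = g t /\ h q0 < h t.
  move=> qr; exists q => [|t ht tq]; first by rewrite /r; lia.
  by have [->//|tr] := eqVneq t r; apply: qmin => //; apply: old.
have swap : g r < g q \/ g r = g q /\ h r < h q ->
    exists2 q0, (a < q0 <= r)%N & forall t, (a < t <= r)%N -> t != q0 ->
    g q0 < g t \/ g q0 = g t /\ h q0 < h t.
  move=> rq; exists r => [|t ht tr]; first by rewrite /r; lia.
  have [->//|tq] := eqVneq t q.
  have := qmin t (old t ht tr) tq; lra.
case: (ltgtP (g q) (g r)) => gqr; [by apply: keep; left | by apply: swap; left |].
by case: (ltgtP (h q) (h r)) hqr => // hqr _; [apply: keep | apply: swap]; right.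
Qed.

(** The lower powers add up to less than the last one, so no choice of signs cancels it. *)
Lemma signed_pow2_neq0 (sgn : nat -> bool) t u : (t < u)%N ->
  \sum_(t <= e < u) (-1) ^+ sgn e * 2 ^+ e != 0 :> R.
Proof.
have bound v : (t <= v)%N ->
    `|\sum_(t <= e < v) (-1) ^+ sgn e * 2 ^+ e| <= 2 ^+ v - 2 ^+ t :> R.
  elim: v => [|v IHv]; first by rewrite leqn0 => /eqP->; rewrite big_geq ?normr0 ?subrr.
  rewrite leq_eqVlt => /orP[/eqP->|]; first by rewrite big_geq ?normr0 ?subrr.
  rewrite ltnS => tv; rewrite big_nat_recr //=; apply: le_trans (ler_normD _ _) _.
  rewrite normrM normr_sign mul1r normrX gtr0_norm // exprS.
  by have := IHv tv; lra.
case: u => // u tu; rewrite big_nat_recr //= addrC; apply/eqP => eq0.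
have := bound u tu; rewrite -normrN.
have -> : - \sum_(t <= e < u) (-1) ^+ sgn e * 2 ^+ e = (-1) ^+ sgn u * 2 ^+ u :> R.
  by apply/eqP; rewrite eq_sym -subr_eq0 opprK; apply/eqP.
rewrite normrM normr_sign mul1r normrX gtr0_norm //.
have t0 : 0 < 2 ^+ t :> R by rewrite exprn_gt0.
lra.
Qed.

Variable n : nat.
Local Notation N := n.+1.
Implicit Types (x u v : 'rV[R]_N) (t e a : nat).

Lemma psum_profile a (Y : nat -> R) : exists x,
  (forall e, (a <= e < a + N)%N -> x 0 (inZp e) = Y e.+1 - Y e) /\
  (forall t, (a <= t <= a + N)%N -> psum x t - psum x a = Y t - Y a).
Proof.
have /choice[l lP] (j : 'I_N) : exists e, (a <= e < a + N)%N /\ inZp e = j.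
  by have [e ? ?] := inZp_lift a j; exists e.
pose x : 'rV[R]_N := \row_j (Y (l j).+1 - Y (l j)).
have xE e : (a <= e < a + N)%N -> x 0 (inZp e) = Y e.+1 - Y e.
  move=> he; have [hl el] := lP (inZp e); rewrite mxE.
  case: (leqP e (l (inZp e))) => le_e.
    by rewrite -(@inZp_inj n e (l (inZp e))) //; lia.
  by rewrite (@inZp_inj n (l (inZp e)) e) //; lia.
exists x; split=> //; elim=> [|t IHt] ht.
  by have -> : a = 0%N by [lia]; rewrite !subrr.
have [<-|neq] := eqVneq a t.+1; first by rewrite !subrr.
rewrite psumS xE; last by lia.
by have := IHt ltac:(lia); lra.
Qed.

(** [P] contains a point in every direction of sum 0 from [x], so its affine hull is the whole
    hyperplane, directed by the kernel of a nonzero linear form on a space of dimension [N]. *)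
Lemma has_affine_dim_sum (P : set 'rV[R]_N) x : P x ->
  (forall y, P y -> \sum_j y 0 j = \sum_j x 0 j) ->
  (forall u, \sum_j u 0 j = 0 -> exists2 d : R, 0 < d & P (x + d *: u)) ->
  has_affine_dim P n.
Proof.
move=> Px sumP openP.
pose f : 'Hom('rV[R]_N, 'rV[R]_1) := linfun (mulmxr (const_mx 1 : 'M[R]_(N, 1))).
have fE u : f u = (\sum_j u 0 j)%:M.
  rewrite lfunE /=; apply/rowP=> i; rewrite (ord1 i) !mxE eqxx mulr1n.
  by apply: eq_bigr => j _; rewrite mxE mulr1.
have memU u : (u \in lker f) = (\sum_j u 0 j == 0).
  rewrite memv_ker fE; apply/eqP/eqP => [/rowP/(_ 0)|->]; last by rewrite raddf0.
  by rewrite !mxE.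
exists x, (lker f); split=> //.
- move=> y Py /=; rewrite memU; under eq_bigr do rewrite !mxE.
  by rewrite sumrB sumP ?subrr.
- move=> W PW; apply/subvP => u; rewrite memU => /eqP/openP[d d0 /PW /=].
  rewrite addrC addKr => /(memvZ d^-1).
  by rewrite scalerA mulVf ?scale1r ?gt_eqF.
- have := limg_ker_dim f fullv; rewrite capfv dimvf.
  have -> : limg f = fullv.
    apply/vspaceP => y; rewrite memvf.
    have -> : y = f (y 0 0 *: delta_mx 0 0).
      rewrite fE; apply/rowP=> i; rewrite (ord1 i) !mxE eqxx mulr1n.
      rewrite (bigD1 0) //= !mxE !eqxx mulr1 big1 ?addr0 // => j nj.
      by rewrite !mxE (negbTE nj) andbF mulr0.
    by rewrite memv_img ?memvf.
  rewrite dimvf !dim_matrix => dimE.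
  by have {dimE}: (\dim (lker f) + 1 * 1 = 1 * N)%N := dimE; rewrite !mul1n addn1 => -[].
Qed.

Variables (k m : nat) (I : 'I_m -> {set 'I_N}).
Hypothesis cardI : forall s, #|I s| = k.

(** For [x] of total [k] the function [psum x - cnt (I s)] is [N]-periodic, so all cuts may be
    represented in one window. *)
Lemma cell_windowP a (q : 'I_m -> nat) x : (forall s, (a < q s <= a + N)%N) ->
  cell k I (fun s => inZp (q s)) x <->
  [/\ forall j, 0 <= x 0 j <= 1, \sum_j x 0 j = k%:R
    & forall s t, (a < t <= a + N)%N ->
      psum x (q s) + (cnt (I s) t)%:R <= psum x t + (cnt (I s) (q s))%:R].
Proof.
move=> hq; rewrite (cellP cardI).
have zmod s (t u : nat) : \sum_j x 0 j = k%:R -> t = u %[mod N] ->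
    psum x t - (cnt (I s) t)%:R = psum x u - (cnt (I s) u)%:R.
  move=> xk tu; pose z := x - indicator_vec R (I s).
  have zE (l : nat) : psum x l - (cnt (I s) l)%:R = psum z l.
    by rewrite /z -scaleN1r psumD psumZ psum_indicator mulN1r.
  rewrite !zE; apply: psum_modn => //.
  by under eq_bigr do rewrite !mxE; rewrite sumrB xk sum_indicator cardI subrr.
have modq s : (inZp (q s) : 'I_N) = q s %[mod N] by rewrite /= modn_mod.
split=> -[x01 xk xmin]; split=> // s t.
  by move=> _; have := xmin s t; have := zmod s _ _ xk (modq s); lra.
have [u hu eu] := lift_mod n a t.
by have := xmin s u hu; have := zmod s _ _ xk (modq s); have := zmod s _ _ xk eu; lra.
Qed.

(** Move [x] slightly in a generic direction [v] of sum 0 and let [q s] be the minimising cut after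
    the move. The moved point satisfies all nontrivial inequalities strictly, and [x] still lies in
    the cell. The fractional coordinate at [a] leaves room for the increment that makes [v] sum to
    0. *)
Lemma full_cell x a : (forall j, 0 <= x 0 j <= 1) -> \sum_j x 0 j = k%:R ->
  0 < x 0 (inZp a) < 1 ->
  exists q : 'I_m -> nat, [/\ forall s, (a < q s <= a + N)%N,
    cell k I (fun s => inZp (q s)) x
    & has_affine_dim (cell (R := R) k I (fun s => inZp (q s))) n].
Proof.
move=> x01 xk /andP[xa0 xa1].
(* The increments of [W] point into the cube wherever [x] is integral, and
   distinct values of [W] break the ties between minimising cuts. *)
pose sgn e := x 0 (inZp e) == 1.
pose W t : R := \sum_(a.+1 <= e < t) (-1) ^+ sgn e * 2 ^+ e.
have WS t : (a < t)%N -> W t.+1 - W t = (-1) ^+ sgn t * 2 ^+ t.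
  by move=> at_; rewrite /W big_nat_recr //= addrAC subrr add0r.
have Winj (t u : nat) : (a < t <= a + N)%N -> (a < u <= a + N)%N -> W t = W u -> t = u.
  have W_neq (t' u' : nat) : (a < t')%N -> (t' < u')%N -> W t' != W u'.
    move=> at' tu'; rewrite eq_sym -subr_eq0 /W (big_cat_nat at' (ltnW tu')) /=.
    by rewrite addrAC subrr add0r signed_pow2_neq0.
  move=> ht hu /eqP; case: (ltngtP t u) => // tu.
    by rewrite (negbTE (W_neq _ _ _ _)) //; lia.
  by rewrite eq_sym (negbTE (W_neq _ _ _ _)) //; lia.
(* Redefining [W] at [a] makes the total increment vanish. *)
have [v [vE vW]] := psum_profile a (fun t => if t == a then W (a + N)%N else W t).
have psumv t : (a < t <= a + N)%N -> psum v t = psum v a + W t - W (a + N)%N.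
  move=> ht; have := vW t ltac:(lia); rewrite eqxx gtn_eqF; [lra | lia].
have v0 : \sum_j v 0 j = 0.
  by have := psumv (a + N)%N ltac:(lia); rewrite psumDN; lra.
have v_sgn j : x 0 j = 0 \/ x 0 j = 1 ->
    exists e : nat, v 0 j = (-1) ^+ (x 0 j == 1) * 2 ^+ e.
  have [e he <-] := inZp_lift a j => xj; exists e.
  have ea : e != a by apply/eqP => ea; move: xj; rewrite ea; lra.
  have e1a : (e.+1 == a) = false by lia.
  by rewrite vE // e1a (negbTE ea) WS //; lia.
have v_gt0 j : x 0 j = 0 -> 0 < v 0 j.
  move=> xj; have [|e ->] := v_sgn j; first by left.
  by rewrite xj eq_sym oner_eq0 mul1r exprn_gt0.
have v_lt0 j : x 0 j = 1 -> v 0 j < 0.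
  move=> xj; have [|e ->] := v_sgn j; first by right.
  by rewrite xj eqxx mulN1r oppr_lt0 exprn_gt0.
have /choice[q qP] s : exists q, (a < q <= a + N)%N /\
    forall t, (a < t <= a + N)%N -> t != q ->
    psum x q - (cnt (I s) q)%:R < psum x t - (cnt (I s) t)%:R \/
    psum x q - (cnt (I s) q)%:R = psum x t - (cnt (I s) t)%:R /\ W q < W t.
  have [//|q hq qmin] := lex_argmin (fun t => psum x t - (cnt (I s) t)%:R) _ Winj.
  by exists q.
have hq s : (a < q s <= a + N)%N by have [] := qP s.
exists q; split=> //.
  apply/(cell_windowP _ hq); split=> // s t ht.
  have [->//|tq] := eqVneq t (q s).
  by have [_ /(_ t ht tq)] := qP s; lra.
pose T : finType := (('I_N + 'I_N) + ('I_m * 'I_N))%type.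
(* At the cut [q s] the cell inequality is an identity without slack; the constant 1 stands in for
   it. *)
pose slack (y : 'rV[R]_N) (c : T) : R := match c with
  | inl (inl j) => y 0 j
  | inl (inr j) => 1 - y 0 j
  | inr (s, i) => if (a.+1 + i)%N == q s then 1 else
      psum y (a.+1 + i) + (cnt (I s) (q s))%:R
      - (psum y (q s) + (cnt (I s) (a.+1 + i))%:R)
  end.
pose lin (u : 'rV[R]_N) (c : T) : R := match c with
  | inl (inl j) => u 0 j
  | inl (inr j) => - u 0 j
  | inr (s, i) => if (a.+1 + i)%N == q s then 0 else
      psum u (a.+1 + i) - psum u (q s)
  end.
have slackD y u d c : slack (y + d *: u) c = slack y c + d * lin u c.
  case: c => [[j|j]|[s i]] /=; rewrite ?mxE; [by [] | lra |].
  by case: eqP => _; [lra | rewrite !psumD !psumZ; lra].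
have slack_cell (y : 'rV[R]_N) : \sum_j y 0 j = k%:R -> (forall c, 0 < slack y c) ->
    cell k I (fun s => inZp (q s)) y.
  move=> yk y0; apply/(cell_windowP _ hq); split=> // [j|s t ht].
    have := y0 (inl (inl j)); have := y0 (inl (inr j)); rewrite /=; lra.
  have ti : (t - a.+1 < N)%N by lia.
  have := y0 (inr (s, Ordinal ti)); rewrite /= subnKC; last by lia.
  by case: eqP => [->//|_]; lra.
have [|d d0 yP] := small_perturbation (alpha := slack x) (beta := lin v).
  case=> [[j|j]|[s i]] /=.
  - have /andP[] := x01 j; rewrite le_eqVlt => /orP[/eqP xj|]; [right | by left].
    by rewrite -xj; split=> //; apply: v_gt0.
  - have /andP[_] := x01 j; rewrite le_eqVlt => /orP[/eqP xj|]; [right | left; lra].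
    by rewrite xj subrr oppr_gt0; split=> //; apply: v_lt0.
  - case: eqP => [_|/eqP tq]; first by left.
    have ht : (a < a.+1 + i <= a + N)%N by have := ltn_ord i; lia.
    have [_ /(_ _ ht tq)] := qP s; rewrite (psumv _ ht) (psumv _ (hq s)).
    by case=> [|[]]; [left | right]; lra.
pose y := x + d *: v.
have ysum : \sum_j y 0 j = k%:R.
  by rewrite -psum_total psumD psumZ !psum_total v0 mulr0 addr0.
apply: (@has_affine_dim_sum _ y).
- by apply: slack_cell => // c; rewrite slackD.
- by move=> z /(cell_windowP _ hq)[_ -> _].
- move=> u u0.
  have [c|d' d'0 y'P] := small_perturbation (alpha := slack y) (beta := lin u).
    by left; rewrite slackD.
  exists d' => //; apply: slack_cell => [|c]; last by rewrite slackD.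
  by rewrite -psum_total psumD psumZ !psum_total u0 mulr0 addr0.
Qed.

End FullCells.

(** * Level crossings of a pair that is not weakly separated *)

Section Crossing.
Local Open Scope ring_scope.

Lemma up_crossing (h : nat -> int) (C : int) u v :
  (forall t, h t.+1 <= h t + 1) -> (u <= v)%N -> h u < C -> C <= h v ->
  exists e, [/\ (u <= e < v)%N, h e = C - 1 & h e.+1 = C].
Proof.
move=> hS; elim: v => [|v IHv] uv hu hv.
  by have := hu; (have -> : u = 0%N by lia); lia.
have neq : u != v.+1 by apply: contraTneq hu => ->; lia.
have [Cv|vC] := lerP C (h v).
  by have [|//|//|e [? ? ?]] := IHv; [lia | exists e; split=> //; lia].
by exists v; have := hS v; split; lia.
Qed.

Lemma down_crossing (h : nat -> int) (C : int) u v :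
  (forall t, h t - 1 <= h t.+1) -> (u <= v)%N -> C <= h u -> h v < C ->
  exists e, [/\ (u <= e < v)%N, h e = C & h e.+1 = C - 1].
Proof.
move=> hS uv hu hv.
have [t | | | |e [? ? ?]] := @up_crossing (fun t => - h t) (1 - C) u v.
- by have := hS t; lia.
- by [].
- lia.
- lia.
- by exists e; split; lia.
Qed.

Variable n : nat.
Local Notation N := n.+1.
Implicit Types (I J : {set 'I_N}) (e t : nat).

(** [h] falls at positions in [I :\: J] and rises at those in [J :\: I]. So around the cycle two
    valleys alternate with two peaks, each valley strictly below both of its neighbouring peaks, and
    a level between them is crossed four times. *)
Lemma four_crossings I J e1 e2 e3 e4 : #|I| = #|J| ->
  (e1 < e2)%N -> (e2 < e3)%N -> (e3 < e4)%N -> (e4 < e1 + N)%N ->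
  inZp e1 \in I :\: J -> inZp e2 \in J :\: I ->
  inZp e3 \in I :\: J -> inZp e4 \in J :\: I ->
  let h t := (cnt J t)%:Z - (cnt I t)%:Z in
  exists (C : int) a b c d,
    [/\ (a < b)%N, (b < c)%N, (c < d)%N & (d < a + N)%N] /\
    [/\ h a = C - 1 /\ h a.+1 = C, h b = C /\ h b.+1 = C - 1,
        h c = C - 1 /\ h c.+1 = C & h d = C /\ h d.+1 = C - 1].
Proof.
move=> cardIJ h12 h23 h34 h41 i1 j1 i2 j2 h.
have hS t : h t.+1 = h t + (inZp t \in J)%:Z - (inZp t \in I)%:Z.
  by rewrite /h !cntS; lia.
have hSle t : h t.+1 <= h t + 1 by rewrite hS; lia.
have hSge t : h t - 1 <= h t.+1 by rewrite hS; lia.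
have hN t : h (t + N)%N = h t by rewrite /h !cntDN cardIJ; lia.
have hdown t : inZp t \in I :\: J -> h t.+1 = h t - 1.
  by rewrite inE => /andP[/negbTE nJ iI]; rewrite hS nJ iI; lia.
have hup t : inZp t \in J :\: I -> h t.+1 = h t + 1.
  by rewrite inE => /andP[/negbTE nI iJ]; rewrite hS nI iJ; lia.
have hi1 := hdown _ i1; have hi2 := hdown _ i2.
have hj1 := hup _ j1; have hj2 := hup _ j2.
have low u v : (u <= v)%N ->
    exists w, [/\ (u <= w <= v)%N, h w <= h u & h w <= h v].
  by move=> uv; case: (lerP (h u) (h v)) => ?; [exists u | exists v]; split; lia.
have high u v : (u <= v)%N ->
    exists w, [/\ (u <= w <= v)%N, h u <= h w & h v <= h w].
  by move=> uv; case: (lerP (h u) (h v)) => ?; [exists v | exists u]; split; lia.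
(* [e1 < e2] unfolds to [e1.+1 <= e2]: the valley is sought after the fall at [e1] and before the
   rise at [e2]. The other three are found likewise. *)
have [v2 [v2b v2l v2r]] := low _ _ h12.
have [p1 [p1b p1l p1r]] := high _ _ h23.
have [v1 [v1b v1l v1r]] := low _ _ h34.
have [p2 [p2b p2l p2r]] := high _ _ h41.
rewrite hN in p2r.
(* [C] is the height of the lower peak. *)
have [C [C1 C2 C3 C4]] : exists C, [/\ h v2 < C, h v1 < C, C <= h p1 & C <= h p2].
  by case: (lerP (h p1) (h p2)) => ?; [exists (h p1) | exists (h p2)]; split; lia.
have [|a [ab ha1 ha2]] := up_crossing hSle _ C1 C3; first by lia.
have [|b [bb hb1 hb2]] := down_crossing hSge _ C3 C2; first by lia.
have [|c [cb hc1 hc2]] := up_crossing hSle _ C2 C4; first by lia.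
have := C1; rewrite -hN => C1'.
have [|d [db hd1 hd2]] := down_crossing hSge _ C4 C1'; first by lia.
exists C, a, b, c, d; split; split=> //; lia.
Qed.

(* [Y] is twice the partial sum function of the point [e_S + (e_a + e_b + e_c + e_d) / 2];
   it lies above [2 cnt J] and [2 cnt I + L], touching both of them on two
   opposite arcs between [a], [b], [c] and [d]. *)
Lemma crossing_profile I J e1 e2 e3 e4 : #|I| = #|J| ->
  (e1 < e2)%N -> (e2 < e3)%N -> (e3 < e4)%N -> (e4 < e1 + N)%N ->
  inZp e1 \in I :\: J -> inZp e2 \in J :\: I ->
  inZp e3 \in I :\: J -> inZp e4 \in J :\: I ->
  exists (Y : nat -> int) (S : nat -> bool) (L : int) a b c d,
  [/\ (a < b)%N, (b < c)%N, (c < d)%N & (d < a + N)%N] /\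
  [/\ Y (a + N)%N = Y a + (2 * #|I|)%N%:Z,
      forall e, (a <= e < a + N)%N ->
        Y e.+1 = Y e + (if e \in [:: a; b; c; d] then 1 else 2 * (S e)%:Z),
      forall t, (a <= t <= a + N)%N ->
        2 * (cnt J t)%:Z <= Y t /\ 2 * (cnt I t)%:Z + L <= Y t,
      2 * (cnt J a.+1)%:Z = Y a.+1 /\ 2 * (cnt J c.+1)%:Z = Y c.+1
    & 2 * (cnt I b.+1)%:Z + L = Y b.+1 /\ 2 * (cnt I d.+1)%:Z + L = Y d.+1].
Proof.
move=> cardIJ h12 h23 h34 h41 i1 j1 i2 j2.
have [C [a [b [c [d [[ab bc cd da]]]]]]] :=
  four_crossings cardIJ h12 h23 h34 h41 i1 j1 i2 j2.
move=> [[ha ha'] [hb hb'] [hc hc'] [hd hd']].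
(* [Y t] is the least integer of prescribed parity above both [2 * cnt J t] and
   [2 * cnt I t + 2 * C - 1]: even on [(a, b]] and [(c, d]], odd elsewhere. The parity changes
   exactly at the four crossings. *)
pose Y t : int := if ((a < t <= b) || (c < t <= d))%N
  then 2 * Num.max (cnt J t)%:Z ((cnt I t)%:Z + C)
  else 2 * Num.max ((cnt I t)%:Z + C) ((cnt J t)%:Z + 1) - 1.
have cI t : exists i : bool, cnt I t.+1 = (cnt I t + i)%N.
  by exists (inZp t \in I); rewrite cntS.
have cJ t : exists i : bool, cnt J t.+1 = (cnt J t + i)%N.
  by exists (inZp t \in J); rewrite cntS.
have JN := cntDN J a; have IN := cntDN I a.
exists Y, (fun e => Y e < Y e.+1), (2 * C - 1), a, b, c, d; split=> //; split.
- by rewrite /Y JN IN; do 2![case: ifP => ?]; lia.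
- move=> e he; rewrite !inE.
  have [i iE] := cI e; have [j jE] := cJ e.
  case: (eqVneq e a) iE jE => [->|ea] iE jE.
    by rewrite /= /Y; do 2![case: ifP => ?]; lia.
  case: (eqVneq e b) iE jE => [->|eb] iE jE.
    by rewrite /= /Y; do 2![case: ifP => ?]; lia.
  case: (eqVneq e c) iE jE => [->|ec] iE jE.
    by rewrite /= /Y; do 2![case: ifP => ?]; lia.
  case: (eqVneq e d) iE jE => [->|ed] iE jE.
    by rewrite /= /Y; do 2![case: ifP => ?]; lia.
  rewrite /= /Y iE jE.
  have -> : ((a < e.+1 <= b) || (c < e.+1 <= d))%N =
      ((a < e <= b) || (c < e <= d))%N by lia.
  by case: ifP => _; lia.
- by move=> t _; rewrite /Y; case: ifP => _; split; lia.
- by rewrite /Y; split; case: ifP => ?; lia.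
- by rewrite /Y; split; case: ifP => ?; lia.
Qed.

End Crossing.

(** * Failure of exchange in an octahedron *)

Section Octahedron.
Local Open Scope ring_scope.
Variables (n k : nat) (Y : nat -> int) (S : nat -> bool) (a b c d : nat).
Local Notation N := n.+1.
Implicit Types (A B X : {set 'I_N}) (e t : nat).
Hypotheses (ab : (a < b)%N) (bc : (b < c)%N) (cd : (c < d)%N) (da : (d < a + N)%N).
Hypothesis YN : Y (a + N)%N = Y a + (2 * k)%N%:Z.
Hypothesis YS : forall e, (a <= e < a + N)%N ->
  Y e.+1 = Y e + (if e \in [:: a; b; c; d] then 1 else 2 * (S e)%:Z).

Definition bit X e : bool := inZp e \in X.

Lemma cnt_bit X t : cnt X t.+1 = (cnt X t + bit X t)%N.
Proof. exact: cntS. Qed.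

(** Among sets of [k] elements these are the vertices of the octahedron centred at the point with
    partial sums [Y / 2], up to a constant. *)
Definition agrees X := forall e, (a <= e < a + N)%N -> e \notin [:: a; b; c; d] ->
  (bit X e) = S e.

Definition excess X t : int := 2 * (cnt X t)%:Z - Y t.

Definition jump X e t : int := if (e < t)%N then 2 * (bit X e)%:Z - 1 else 0.

Lemma excess_agrees X t : agrees X -> (a <= t <= a + N)%N ->
  excess X t = excess X a + jump X a t + jump X b t + jump X c t + jump X d t.
Proof.
move=> agX; elim: t => [|t IHt] ht.
  by have -> : a = 0%N; [lia | rewrite /jump !ltn0 !addr0].
have [<-|neq] := eqVneq a t.+1; first by rewrite /jump; do !case: ifP => ?; lia.
have excS : excess X t.+1 = excess X t + 2 * (bit X t)%:Z -
    (if t \in [:: a; b; c; d] then 1 else 2 * (S t)%:Z).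
  rewrite /excess cnt_bit YS; last by lia.
  by move: (if _ then _ else _) => z; lia.
have jumpS e : jump X e t.+1 = jump X e t +
    (if t == e then 2 * (bit X t)%:Z - 1 else 0).
  rewrite /jump; case: eqP => [<-|te]; first by rewrite ltnSn ltnn add0r.
  by rewrite addr0; have -> : (e < t.+1)%N = (e < t)%N by lia.
rewrite excS IHt; last by lia.
rewrite !jumpS !inE.
have [ta|ta] := eqVneq t a; first by rewrite !ifF /=; lia.
have [tb|tb] := eqVneq t b; first by rewrite !ifF /=; lia.
have [tc|tc] := eqVneq t c; first by rewrite !ifF /=; lia.
have [td|td] := eqVneq t d; first by rewrite /=; lia.
rewrite /= agX; [lia | lia |].
by rewrite !inE (negbTE ta) (negbTE tb) (negbTE tc) (negbTE td).
Qed.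

Lemma agrees_card X : agrees X -> #|X| = k ->
  ((bit X a) + (bit X b) + (bit X c) + (bit X d) = 2)%N.
Proof.
move=> agX cX; have := excess_agrees agX (t := a + N) ltac:(lia).
rewrite /excess YN cntDN cX /jump.
have -> : (a < a + N)%N by lia.
have -> : (b < a + N)%N by lia.
have -> : (c < a + N)%N by lia.
have -> : (d < a + N)%N by lia.
by lia.
Qed.

Lemma inZp_window e f : (a <= e < a + N)%N -> (a <= f < a + N)%N ->
  (inZp e == inZp f :> 'I_N) = (e == f).
Proof.
move=> he hf; apply/eqP/eqP => [eq_ef|->//]; case: (leqP e f) => le_ef.
  by apply: (@inZp_inj n) => //; lia.
by apply/esym/(@inZp_inj n) => //; lia.
Qed.

(** [A] and [B] differ only at the four positions, so the element exchanged in is one of these and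
    the new basis is again a vertex of the octahedron. *)
Lemma agrees_exchange (BB : {set {set 'I_N}}) A B f : matroid_bases k BB ->
  A \in BB -> B \in BB -> agrees A -> agrees B -> f \in [:: a; b; c; d] ->
  bit A f -> ~~ bit B f ->
  exists g X, [/\ g \in [:: a; b; c; d], bit B g && ~~ bit A g, X \in BB, agrees X
    & forall e, (a <= e < a + N)%N ->
      (bit X e) = (e == g) || (e != f) && (bit A e)].
Proof.
move=> [_ _ exch] AB BB' agA agB fabcd fA fB.
have [|y yBA XBB] := exch A B AB BB' (inZp f); first by rewrite inE fB.
have [g hg eg] := inZp_lift a y; rewrite -eg in yBA XBB.
have gabcd : g \in [:: a; b; c; d].
  apply: contraTT yBA => ng; rewrite inE -/(bit A g) -/(bit B g) agA // agB //.
  by case: (S g).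
have hf : (a <= f < a + N)%N.
  by move: fabcd; rewrite !inE => /or4P[] /eqP->; lia.
have XE e : (a <= e < a + N)%N -> bit (inZp g |: A :\ inZp f) e =
    (e == g) || (e != f) && (bit A e).
  by move=> he; rewrite /bit !inE !inZp_window.
exists g, (inZp g |: A :\ inZp f); split=> //.
  by move: yBA; rewrite inE andbC.
move=> e he neabcd.
rewrite XE // agA //.
have -> : (e == g) = false by apply: contraNF neabcd => /eqP->.
by have -> : (e == f) = false by apply: contraNF neabcd => /eqP->.
Qed.

(** On the four positions the equalities force [A] to be [{a, c}] and [B] to be [{b, d}]. The arc of
    [q1] excludes [{a, b}] or [{c, d}], that of [q2] excludes [{a, d}] or [{b, c}]. The two excluded
    pairs share an element of [A] or of [B]; removing the other element of that set leaves only
    excluded exchanges. *)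
Lemma octahedron_not_matroid (BB : {set {set 'I_N}}) q1 q2 A B :
  matroid_bases k BB ->
  (a < q1 <= a + N)%N -> (a < q2 <= a + N)%N ->
  (forall X, X \in BB ->
    [/\ excess X q1 <= excess X b.+1, excess X q1 <= excess X d.+1,
        excess X q2 <= excess X a.+1 & excess X q2 <= excess X c.+1]) ->
  A \in BB -> B \in BB -> agrees A -> agrees B ->
  bit A a -> ~~ bit B a ->
  (forall X, X = A \/ X = B ->
    [/\ excess X q1 = excess X b.+1, excess X q1 = excess X d.+1,
        excess X q2 = excess X a.+1 & excess X q2 = excess X c.+1]) ->
  False.
Proof.
move=> matBB hq1 hq2 ineq AB BB' agA agB aA aB eqAB.
have [_ cardBB _] := matBB.
have wa : (a <= a < a + N)%N by lia.
have wb : (a <= b < a + N)%N by lia.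
have wc : (a <= c < a + N)%N by lia.
have wd : (a <= d < a + N)%N by lia.
have [ac ad bd] : [/\ (a < c)%N, (a < d)%N & (b < d)%N] by split; lia.
have neq := (ltn_eqF ab, gtn_eqF ab, ltn_eqF ac, gtn_eqF ac, ltn_eqF ad, gtn_eqF ad,
  ltn_eqF bc, gtn_eqF bc, ltn_eqF bd, gtn_eqF bd, ltn_eqF cd, gtn_eqF cd).
have exE X t : agrees X -> (a < t <= a + N)%N ->
    excess X t = excess X a.+1 + jump X b t + jump X c t + jump X d t.
  move=> agX ht; rewrite (excess_agrees agX (t := t)); last by lia.
  rewrite (excess_agrees agX (t := a.+1)); last by lia.
  rewrite /jump ltnSn; have -> : (a < t)%N by lia.
  have -> : (b < a.+1)%N = false by lia.
  have -> : (c < a.+1)%N = false by lia.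
  by have -> : (d < a.+1)%N = false; lia.
have exloc X t u : agrees X -> (a < t <= a + N)%N -> (a < u <= a + N)%N ->
    (b < t)%N = (b < u)%N -> (c < t)%N = (c < u)%N -> (d < t)%N = (d < u)%N ->
    excess X t = excess X u.
  by move=> agX ht hu tb tc td; rewrite exE // [RHS]exE // /jump tb tc td.
have exval X : agrees X ->
    [/\ excess X b.+1 = excess X a.+1 + (2 * (bit X b)%:Z - 1),
        excess X c.+1 = excess X b.+1 + (2 * (bit X c)%:Z - 1)
      & excess X d.+1 = excess X c.+1 + (2 * (bit X d)%:Z - 1)].
  move=> agX; have hb : (a < b.+1 <= a + N)%N by lia.
  have hc : (a < c.+1 <= a + N)%N by lia.
  have hd : (a < d.+1 <= a + N)%N by lia.
  rewrite (exE _ _ agX hb) (exE _ _ agX hc) (exE _ _ agX hd) /jump !ltnSn.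
  have -> : (c < b.+1)%N = false by lia.
  have -> : (d < b.+1)%N = false by lia.
  have -> : (d < c.+1)%N = false by lia.
  have -> : (b < c.+1)%N by lia.
  have -> : (b < d.+1)%N by lia.
  have -> : (c < d.+1)%N by lia.
  by rewrite !addr0.
have excase t : (a < t <= a + N)%N ->
    [\/ (t <= b)%N /\ forall X, agrees X -> excess X t = excess X a.+1,
        (b < t <= c)%N /\ forall X, agrees X -> excess X t = excess X b.+1,
        (c < t <= d)%N /\ forall X, agrees X -> excess X t = excess X c.+1
      | (d < t)%N /\ forall X, agrees X -> excess X t = excess X d.+1].
  move=> ht; have [tb|bt] := leqP t b.
    by constructor 1; split=> // X agX; apply: exloc => //; lia.
  have [tc|ct] := leqP t c.
    by constructor 2; split=> // X agX; apply: exloc => //; lia.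
  have [td|dt] := leqP t d.
    by constructor 3; split=> // X agX; apply: exloc => //; lia.
  by constructor 4; split=> // X agX; apply: exloc => //; lia.
have [A1 A2 A3 A4] := eqAB A (or_introl erefl).
have [B1 B2 B3 B4] := eqAB B (or_intror erefl).
have cA := agrees_card agA (cardBB _ AB).
have cB := agrees_card agB (cardBB _ BB').
have [bA cA' dA] : [/\ ~~ bit A b, bit A c & ~~ bit A d].
  have [e1 e2 e3] := exval _ agA; move: aA cA e1 e2 e3 A1 A2 A3 A4; clear.
  case: (bit A a) => // _; case: (bit A b); case: (bit A c); case: (bit A d) => //=; lia.
have [bB cB' dB] : [/\ bit B b, ~~ bit B c & bit B d].
  have [e1 e2 e3] := exval _ agB; move: aB cB e1 e2 e3 B1 B2 B3 B4; clear.
  case: (bit B a) => // _; case: (bit B b); case: (bit B c); case: (bit B d) => //=; lia.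
have [Ab Ac Ad] := exval _ agA; rewrite (negbTE bA) cA' (negbTE dA) in Ab Ac Ad.
(* The excess of [A] alternates between two values on the four arcs, so [q1] lies after [b] or after
   [d]. *)
have q1E : [\/ forall X, agrees X -> excess X q1 = excess X b.+1
             | forall X, agrees X -> excess X q1 = excess X d.+1].
  case: (excase q1 hq1) => [[_ /(_ A agA)]|[_ h]|[_ /(_ A agA)]|[_ h]];
    by [left | right | move=> h; exfalso; move: A1 Ab Ac h; clear; lia].
have q2E : [\/ forall X, agrees X -> excess X q2 = excess X a.+1
             | forall X, agrees X -> excess X q2 = excess X c.+1].
  case: (excase q2 hq2) => [[_ h]|[_ /(_ A agA)]|[_ h]|[_ /(_ A agA)]];
    by [left | right | move=> h; exfalso; move: A3 Ab Ac Ad h; clear; lia].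
have q1X : (forall X, X \in BB -> agrees X -> (1 <= bit X c + bit X d)%N) \/
    (forall X, X \in BB -> agrees X -> (bit X c + bit X d <= 1)%N).
  case: q1E => q1E; [left | right] => X XBB agX; have [e1 e2 e3] := exval _ agX;
    have [X1 X2 _ _] := ineq X XBB; move: X1 X2 e2 e3; rewrite q1E //; clear; lia.
have q2X : (forall X, X \in BB -> agrees X -> (1 <= bit X b + bit X c)%N) \/
    (forall X, X \in BB -> agrees X -> (bit X b + bit X c <= 1)%N).
  case: q2E => q2E; [left | right] => X XBB agX; have [e1 e2 e3] := exval _ agX;
    have [_ _ X1 X2] := ineq X XBB; move: X1 X2 e1 e2; rewrite q2E //; clear; lia.
have solve U V f : U \in BB -> V \in BB -> agrees U -> agrees V ->
    f \in [:: a; b; c; d] -> bit U f -> ~~ bit V f ->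
    (forall g X, g \in [:: a; b; c; d] -> bit V g && ~~ bit U g ->
      [/\ bit X a = (a == g) || (a != f) && bit U a,
          bit X b = (b == g) || (b != f) && bit U b,
          bit X c = (c == g) || (c != f) && bit U c
        & bit X d = (d == g) || (d != f) && bit U d] ->
      X \in BB -> agrees X -> False) -> False.
  move=> UB VB agU agV fabcd fU fV k0.
  have [g [X [gabcd gVU XBB agX XE]]] := agrees_exchange matBB UB VB agU agV fabcd fU fV.
  by apply: (k0 g X) => //; rewrite !XE.
case: q1X => q1X; case: q2X => q2X.
- apply: (solve A B c) => //; first by rewrite !inE eqxx ?orbT.
  move=> g X gabcd gUV [Xa Xb Xc Xd] XBB agX.
  move: (q1X X XBB agX) (q2X X XBB agX); rewrite Xb Xc Xd.
  move: gabcd gUV; rewrite !inE => /or4P[] /eqP->;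
    by rewrite ?aA ?(negbTE aB) ?(negbTE bA) ?cA' ?(negbTE dA) ?bB ?(negbTE cB')
      ?dB ?eqxx ?neq.
- apply: (solve B A d) => //; first by rewrite !inE eqxx ?orbT.
  move=> g X gabcd gUV [Xa Xb Xc Xd] XBB agX.
  move: (q1X X XBB agX) (q2X X XBB agX); rewrite Xb Xc Xd.
  move: gabcd gUV; rewrite !inE => /or4P[] /eqP->;
    by rewrite ?aA ?(negbTE aB) ?(negbTE bA) ?cA' ?(negbTE dA) ?bB ?(negbTE cB')
      ?dB ?eqxx ?neq.
- apply: (solve B A b) => //; first by rewrite !inE eqxx ?orbT.
  move=> g X gabcd gUV [Xa Xb Xc Xd] XBB agX.
  move: (q1X X XBB agX) (q2X X XBB agX); rewrite Xb Xc Xd.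
  move: gabcd gUV; rewrite !inE => /or4P[] /eqP->;
    by rewrite ?aA ?(negbTE aB) ?(negbTE bA) ?cA' ?(negbTE dA) ?bB ?(negbTE cB')
      ?dB ?eqxx ?neq.
- apply: (solve A B a) => //; first by rewrite !inE eqxx ?orbT.
  move=> g X gabcd gUV [Xa Xb Xc Xd] XBB agX.
  move: (q1X X XBB agX) (q2X X XBB agX); rewrite Xb Xc Xd.
  move: gabcd gUV; rewrite !inE => /or4P[] /eqP->;
    by rewrite ?aA ?(negbTE aB) ?(negbTE bA) ?cA' ?(negbTE dA) ?bB ?(negbTE cB')
      ?dB ?eqxx ?neq.
Qed.

End Octahedron.

(** * A full-dimensional cell that is not a matroid polytope *)

Section CrossingCell.
Local Open Scope ring_scope.
Local Open Scope classical_set_scope.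
Variables (R : realType) (n k m : nat) (I : 'I_m -> {set 'I_n.+1}).
Local Notation N := n.+1.
Hypothesis cardI : forall s, #|I s| = k.

(** This shows that a linear inequality tight at a convex combination is tight at every point of
    positive weight. *)
Lemma weighted_sum_eq0 r (w g : 'I_r -> R) : (forall i, 0 <= w i) ->
  (forall i, 0 <= g i) -> \sum_i w i * g i = 0 -> forall i, 0 < w i -> g i = 0.
Proof.
move=> w0 g0 sum0 i wi.
have /(_ i isT)/eqP := psumr_eq0P (fun j _ => mulr_ge0 (w0 j) (g0 j)) sum0.
by rewrite mulf_eq0 gt_eqF //= => /eqP.
Qed.

Lemma conv_hull_sub (V : lmodType R) (S : set V) x : S x -> conv_hull S x.
Proof.
move=> Sx; exists 1%N, (fun=> x), (fun=> 1); by split; rewrite ?big_ord1 ?scale1r.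
Qed.

(** The point [x] with profile [Y / 2] lies in a full-dimensional cell, so it would be a convex
    combination of bases. Those of positive weight agree with [S] and satisfy the touching
    inequalities with equality. As [x] has coordinate 1/2 at [a], one of them contains [a] and
    another does not. *)
Lemma crossing_not_matroid s1 s2 e1 e2 e3 e4 :
  (e1 < e2)%N -> (e2 < e3)%N -> (e3 < e4)%N -> (e4 < e1 + N)%N ->
  (inZp e1 \in I s1 :\: I s2)%SET -> (inZp e2 \in I s2 :\: I s1)%SET ->
  (inZp e3 \in I s1 :\: I s2)%SET -> (inZp e4 \in I s2 :\: I s1)%SET ->
  ~ blades_induce_matroid_subdivision k (fun s => indicator_vec R (I s)).
Proof.
move=> h12 h23 h34 h41 i1 j1 i2 j2 mat.
have card12 : #|I s1| = #|I s2| by rewrite !cardI.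
have [Y [S [L [a [b [c [d [[ab bc cd da]]]]]]]]] :=
  crossing_profile card12 h12 h23 h34 h41 i1 j1 i2 j2.
have [wa wb wc wd] : [/\ (a < a.+1 <= a + N)%N, (a < b.+1 <= a + N)%N,
  (a < c.+1 <= a + N)%N & (a < d.+1 <= a + N)%N] by split; lia.
have win t : (a < t <= a + N)%N -> (a <= t <= a + N)%N by lia.
rewrite cardI => -[YN YS Ymin [Ya Yc] [Yb Yd]].
have [x [xE xY]] := @psum_profile R n a (fun t => (Y t)%:~R / 2%:R : R).
have xS e : (a <= e < a + N)%N -> x 0 (inZp e) =
    if e \in [:: a; b; c; d] then 2%:R^-1 else (S e)%:R.
  move=> he; rewrite xE // YS // intrD mulrDl addrAC subrr add0r.
  case: ifP => _; first by rewrite mul1r.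
  by case: (S e); rewrite ?mul0r // divff ?pnatr_eq0.
have x01 j : 0 <= x 0 j <= 1.
  have [e he <-] := inZp_lift a j; rewrite xS //.
  case: ifP => _; last by case: (S e); rewrite ?lexx ?ler01.
  by apply/andP; split; lra.
have xk : \sum_j x 0 j = k%:R.
  have YNR : (Y (a + N)%N)%:~R = (Y a)%:~R + 2%:R * k%:R :> R.
    by rewrite YN intrD PoszM intrM.
  by have := xY (a + N)%N ltac:(lia); rewrite psumDN YNR; lra.
have xa : x 0 (inZp a) = 2%:R^-1 by rewrite xS ?inE ?eqxx //; lia.
have xa01 : 0 < x 0 (inZp a) < 1 by rewrite xa; apply/andP; split; lra.
have [q [hq cellx dimx]] := full_cell cardI x01 xk xa01.
have [BB matBB cellE] : matroid_polytope k (cell (R := R) k I (fun s => inZp (q s))).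
  by apply: mat; apply/blade_maximal_cellP; exists (fun s => inZp (q s)).
have BBmin X s t : X \in BB -> (a < t <= a + N)%N ->
    (cnt X (q s) + cnt (I s) t <= cnt X t + cnt (I s) (q s))%N.
  move=> XBB ht; have : cell k I (fun s => inZp (q s)) (indicator_vec R X).
    by rewrite cellE; apply: conv_hull_sub; exists X.
  move=> /(cell_windowP cardI _ hq)[_ _ /(_ s t ht)].
  by rewrite !psum_indicator -!natrD ler_nat.
have psum2 t u : (a <= t <= a + N)%N -> (a <= u <= a + N)%N ->
    2%:R * (psum x t - psum x u) = (Y t)%:~R - (Y u)%:~R.
  by move=> /xY ht /xY hu; lra.
have Yq s t : (a < t <= a + N)%N ->
    Y (q s) - 2 * (cnt (I s) (q s))%:Z <= Y t - 2 * (cnt (I s) t)%:Z.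
  move=> ht; have := (cell_windowP cardI _ hq).1 cellx => -[_ _ /(_ s t ht)].
  have := psum2 t (q s) (win _ ht) (win _ (hq s)).
  rewrite -(ler_int R) !intrD !rmorphN !rmorphM /=.
  by rewrite -!pmulrn; lra.
(* On the window [q s1] minimises [Y - 2 * cnt (I s1)], whose least value [L] is attained at
   [b.+1]. *)
have Yq1 : Y (q s1) = 2 * (cnt (I s1) (q s1))%:Z + L.
  have := Yq s1 b.+1 wb; have := (Ymin (q s1) (win _ (hq s1))).2; lia.
have Yq2 : Y (q s2) = 2 * (cnt (I s2) (q s2))%:Z.
  have := Yq s2 a.+1 wa; have := (Ymin (q s2) (win _ (hq s2))).1; lia.
have ineq X : X \in BB ->
    [/\ excess Y X (q s1) <= excess Y X b.+1, excess Y X (q s1) <= excess Y X d.+1,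
        excess Y X (q s2) <= excess Y X a.+1 & excess Y X (q s2) <= excess Y X c.+1].
  move=> XBB; rewrite /excess Yq1 Yq2 -Ya -Yb -Yc -Yd.
  have := BBmin X s1 b.+1 XBB wb; have := BBmin X s1 d.+1 XBB wd.
  have := BBmin X s2 a.+1 XBB wa; have := BBmin X s2 c.+1 XBB wc.
  by clear; split; lia.
have [r [v [w [vB w0 w1 xw]]]] : conv_hull [set indicator_vec R B | B in [set` BB]] x.
  by rewrite -cellE.
have /choice[B BP] i : exists B, B \in BB /\ v i = indicator_vec R B.
  by have [B BBB <-] := vB i; exists B.
have BBB i : B i \in BB by have [] := BP i.
have wj j : \sum_i w i * (j \in B i)%:R = x 0 j.
  rewrite xw summxE; apply: eq_bigr => i _.
  by have [_ ->] := BP i; rewrite mxE indicator_vecE.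
have wcnt t : \sum_i w i * (cnt (B i) t)%:R = psum x t.
  rewrite xw psum_sum; apply: eq_bigr => i _.
  by have [_ ->] := BP i; rewrite psum_indicator.
have supp_bit i j (z : bool) : 0 < w i -> x 0 j = z%:R -> (j \in B i) = z.
  move=> wi xj; pose g i := ((j \in B i) != z)%:R : R.
  have gE l : w l * g l = (-1) ^+ z * (w l * (j \in B l)%:R - w l * z%:R).
    by rewrite /g; case: z {xj g}; case: (j \in B l);
      rewrite /= ?expr1 ?expr0
        !(mulr0, mulr1, mul1r, mulN1r, subrr, sub0r, subr0) ?opprK ?oppr0.
  suff /(weighted_sum_eq0 w0 (fun l => ler0n _ _))/(_ i wi)/eqP : \sum_l w l * g l = 0.
    by rewrite pnatr_eq0 eqb0 negbK => /eqP.
  under eq_bigr do rewrite gE.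
  by rewrite -mulr_sumr sumrB wj -mulr_suml w1 xj mul1r subrr mulr0.
have agB i : 0 < w i -> agrees S a b c d (B i).
  by move=> wi e he /negbTE ne; apply: supp_bit => //; rewrite xS // ne.
(* The increments of [psum x] are half those of [Y], so the weighted mean of the excess differences
   is 0. *)
have eqB i s t : 0 < w i -> (a < t <= a + N)%N ->
    (forall X, X \in BB -> excess Y X (q s) <= excess Y X t) ->
    excess Y (B i) (q s) = excess Y (B i) t.
  move=> wi ht le_ex; pose g i : R := (excess Y (B i) t - excess Y (B i) (q s))%:~R.
  have g0 l : 0 <= g l by rewrite /g ler0z subr_ge0 le_ex.
  suff /(weighted_sum_eq0 w0 g0)/(_ i wi)/eqP : \sum_l w l * g l = 0.
    by rewrite /g intr_eq0 subr_eq0 => /eqP.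
  have gE l : w l * g l = 2%:R * (w l * (cnt (B l) t)%:R - w l * (cnt (B l) (q s))%:R)
      - w l * ((Y t)%:~R - (Y (q s))%:~R).
    by rewrite /g /excess !intrB !intrM -!pmulrn; lra.
  under eq_bigr do rewrite gE.
  rewrite sumrB -mulr_sumr sumrB !wcnt -mulr_suml w1 mul1r.
  by rewrite psum2 ?subrr //; apply: win.
have supp (z : bool) : exists i, 0 < w i /\ (inZp a \in B i) = z.
  apply: contrapT => nex.
  have := wj (inZp a); rewrite xa.
  have wE l : w l * (inZp a \in B l)%:R = w l * (~~ z)%:R.
    have := w0 l; rewrite le_eqVlt => /orP[/eqP<-|wl]; first by rewrite !mul0r.
    suff -> : (inZp a \in B l) = ~~ z by [].
    have ne_z : (inZp a \in B l) <> z by move=> eq_z; apply: nex; exists l.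
    by move: ne_z; case: (z); case: (_ \in _).
  under eq_bigr do rewrite wE.
  by rewrite -mulr_suml w1 mul1r; case: (z) => /=; lra.
have [iA [wA aA]] := supp true; have [iB [wB aB]] := supp false.
apply: (@octahedron_not_matroid n k Y S a b c d ab bc cd da YN YS BB (q s1) (q s2)
  (B iA) (B iB)) => //; try exact: agB.
- exact: BBB.
- exact: BBB.
- exact: negbT aB.
- move=> X XAB; have {XAB}[i wi ->] : exists2 i, 0 < w i & X = B i.
    by case: XAB => ->; [exists iA | exists iB].
  split.
  - by apply: eqB wi wb _ => X' /ineq[].
  - by apply: eqB wi wd _ => X' /ineq[].
  - by apply: eqB wi wa _ => X' /ineq[].
  - by apply: eqB wi wc _ => X' /ineq[].
Qed.

End CrossingCell.

Theorem theorem33 (R : realType) (n k m : nat) (I : 'I_m -> {set 'I_n})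
    (hk : (2 <= k)%N) (hkn : (k + 2 <= n)%N)
    (hI : forall a : 'I_m, #|I a| = k) :
  blades_induce_matroid_subdivision k (fun a : 'I_m => indicator_vec R (I a)) <->
  weakly_separated_collection [set I a | a : 'I_m]%SET.
Proof.
case: n I hkn hI => [|n] I hkn hI; first by lia.
split=> [mat _ _ /imsetP[s1 _ ->] /imsetP[s2 _ ->] _|wsI P].
  case=> [i1 [i2 [j1 [j2 [i1P i2P j1P j2P cyc]]]]].
  have [e1 [e2 [e3 [e4 [[h12 h23 h34 h41] [E1 E2 E3 E4]]]]]] :=
    cyclically_ordered_lift cyc.
  rewrite -E1 -E2 -E3 -E4 in i1P i2P j1P j2P.
  exact: crossing_not_matroid h12 h23 h34 h41 i1P j1P i2P j2P mat.
(* Having an affine dimension provides a point of the cell, which makes its set of bases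
   nonempty. *)
move=> /blade_maximal_cellP[p -> [x [U [xP _ _ _]]]].
by apply: cell_matroid => //; exists x.
Qed.
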